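(* Let $X$ be a Banach space and $k\in\mathbb{N}$. If $\mathcal{SM}^{wrc}_k(X)$ contains a sequence equivalent to the usual basis of $c_0$, then the dual $X^*$ admits a $k$-spreading model equivalent to the usual basis of $\ell^1$, i.e. there is a $k$-sequence in $X^*$ generating a $k$-spreading model equivalent to the usual basis of $\ell^1$.
   Context: $[M]^k$: $k$-subsets of $M\subseteq\mathbb{N}$ (increasing enumerations, $M(l)$ the $l$-th element). A $k$-sequence in a Banach space $Y$ is a map $[\mathbb{N}]^k\to Y$. Plegma family: $(s_j)_{j=1}^l$ in $[M]^k$ with $s_1(i)<\dots<s_l(i)$ ($i\le k$), $s_l(i)<s_1(i+1)$ ($i<k$). $(x_s)_{s\in[M]^k}$ generates the Hamel basis $(e_n)$ of a seminormed space $(E,\|\cdot\|_* )$ as a $k$-spreading model if for a null sequence $\delta_l>0$: $|\|\sum_{j=1}^m a_jx_{s_j}\|-\|\sum_{j=1}^m a_je_j\|_*|\le\delta_l$ for all $m\le l$, plegma $(s_j)_{j=1}^m$ in $[M]^k$ with $s_1(1)\ge M(l)$, $a_j\in[-1,1]$. A $k$-sequence is weakly relatively compact if the weak closure of its set of values is weakly compact; $\mathcal{SM}^{wrc}_k(X)$ is the set of sequences generated as $k$-spreading models by weakly relatively compact $k$-sequences in $X$. *)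

(* Defs.v *)
From Stdlib Require Import Reals Lra Lia List Sorted ClassicalEpsilon.
Open Scope R_scope.

Record Banach := mkBanach {
  B :> Type;
  bzero : B;
  badd : B -> B -> B;
  bopp : B -> B;
  bscal : R -> B -> B;
  bnorm : B -> R;
  badd_assoc : forall x y z, badd x (badd y z) = badd (badd x y) z;
  badd_comm : forall x y, badd x y = badd y x;
  badd_0 : forall x, badd x bzero = x;
  badd_opp : forall x, badd x (bopp x) = bzero;
  bscal_1 : forall x, bscal 1 x = x;
  bscal_assoc : forall a b x, bscal a (bscal b x) = bscal (a * b) x;
  bscal_distr_vec : forall a x y, bscal a (badd x y) = badd (bscal a x) (bscal a y);
  bscal_distr_scal : forall a b x, bscal (a + b) x = badd (bscal a x) (bscal b x);
  bnorm_eq0 : forall x, bnorm x = 0 -> x = bzero;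
  bnorm_triangle : forall x y, bnorm (badd x y) <= bnorm x + bnorm y;
  bnorm_scal : forall a x, bnorm (bscal a x) = Rabs a * bnorm x;
  bcomplete : forall u : nat -> B,
    (forall eps, 0 < eps -> exists N, forall n m, (N <= n)%nat -> (N <= m)%nat ->
        bnorm (badd (u n) (bopp (u m))) < eps) ->
    exists l, forall eps, 0 < eps -> exists N, forall n, (N <= n)%nat ->
        bnorm (badd (u n) (bopp l)) < eps
}.

Definition is_blf (X : Banach) (f : X -> R) : Prop :=
  (forall x y, f (badd X x y) = f x + f y) /\
  (forall a x, f (bscal X a x) = a * f x) /\
  (exists C, forall x, Rabs (f x) <= C * bnorm X x).

Definition dnorm (X : Banach) (g : X -> R) : R :=
  epsilon (inhabits 0)
    (fun r => is_lub (fun t => exists x, bnorm X x <= 1 /\ t = Rabs (g x)) r).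

Definition weak_nbhd (X : Banach) (x : X) (U : X -> Prop) : Prop :=
  exists (fs : list (X -> R)) (eps : R),
    Forall (is_blf X) fs /\ 0 < eps /\
    forall y, (forall f, In f fs -> Rabs (f y - f x) < eps) -> U y.

Definition weak_open (X : Banach) (U : X -> Prop) : Prop :=
  forall x, U x -> weak_nbhd X x U.

Definition weak_closure (X : Banach) (A : X -> Prop) : X -> Prop :=
  fun x => forall U, weak_nbhd X x U -> exists y, A y /\ U y.

Definition weak_compact (X : Banach) (K : X -> Prop) : Prop :=
  forall (I : Type) (U : I -> X -> Prop),
    (forall i, weak_open X (U i)) ->
    (forall x, K x -> exists i, U i x) ->
    exists l : list I, forall x, K x -> exists i, In i l /\ U i x.

(* An infinite M ⊆ ℕ is given by its strictly increasing enumeration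
   M : nat -> nat (M 0 = first element, i.e. M(1) of the paper). *)
Definition strictly_incr (M : nat -> nat) : Prop := forall i, (M i < M (S i))%nat.

Definition ksub (k : nat) (M : nat -> nat) (s : list nat) : Prop :=
  length s = k /\ Sorted lt s /\ Forall (fun n => exists i, M i = n) s.

Definition ksubN (k : nat) (s : list nat) : Prop := ksub k (fun i => i) s.

(* (ss 0, ..., ss (m-1)) is a plegma family (0-based coordinates:
   s(i) of the paper with i = 1..k is nth (i-1) s 0). *)
Definition plegma (k m : nat) (ss : nat -> list nat) : Prop :=
  forall i, (i < k)%nat ->
    (forall j, (S j < m)%nat -> (nth i (ss j) 0 < nth i (ss (S j)) 0)%nat) /\
    ((S i < k)%nat -> (nth i (ss (pred m)) 0 < nth (S i) (ss 0%nat) 0)%nat).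

(** * Seminormed spaces with a Hamel basis (e_n), in coordinates:
   the vector sum_j a_j e_j (a finitely supported) has seminorm sn a. *)
Definition fin_supp (a : nat -> R) : Prop := exists N, forall j, (N <= j)%nat -> a j = 0.

Definition is_seminorm_coord (sn : (nat -> R) -> R) : Prop :=
  (forall a, fin_supp a -> 0 <= sn a) /\
  (forall a b, fin_supp a -> fin_supp b -> sn (fun j => a j + b j) <= sn a + sn b) /\
  (forall c a, fin_supp a -> sn (fun j => c * a j) = Rabs c * sn a).

Definition trunc (m : nat) (a : nat -> R) : nat -> R :=
  fun j => if Nat.ltb j m then a j else 0.

Fixpoint comb {V : Type} (vzero : V) (vadd : V -> V -> V) (vscal : R -> V -> V)
  (x : list nat -> V) (m : nat) (a : nat -> R) (ss : nat -> list nat) : V :=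
  match m with
  | O => vzero
  | S m' => vadd (comb vzero vadd vscal x m' a ss) (vscal (a m') (x (ss m')))
  end.

(* (x_s) generates (e_n) (given by sn) as a k-spreading model; 1-based l as in the paper. *)
Definition gen_spreading_model {V : Type} (vzero : V) (vadd : V -> V -> V)
  (vscal : R -> V -> V) (vnorm : V -> R)
  (k : nat) (x : list nat -> V) (sn : (nat -> R) -> R) : Prop :=
  exists (M : nat -> nat) (delta : nat -> R),
    strictly_incr M /\ (forall l, 0 < delta l) /\ Un_cv delta 0 /\
    forall (l m : nat) (ss : nat -> list nat) (a : nat -> R),
      (1 <= m)%nat -> (m <= l)%nat ->
      (forall j, (j < m)%nat -> ksub k M (ss j)) ->
      plegma k m ss ->
      (M (pred l) <= nth 0 (ss 0%nat) 0)%nat ->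
      (forall j, (j < m)%nat -> -1 <= a j <= 1) ->
      Rabs (vnorm (comb vzero vadd vscal x m a ss) - sn (trunc m a)) <= delta l.

Definition wrc_kseq (X : Banach) (k : nat) (x : list nat -> X) : Prop :=
  weak_compact X (weak_closure X (fun y => exists s, ksubN k s /\ x s = y)).

Definition in_SM_wrc (X : Banach) (k : nat) (sn : (nat -> R) -> R) : Prop :=
  is_seminorm_coord sn /\
  exists x : list nat -> X, wrc_kseq X k x /\
    gen_spreading_model (bzero X) (badd X) (bscal X) (bnorm X) k x sn.

Fixpoint maxabs (m : nat) (a : nat -> R) : R :=
  match m with O => 0 | S m' => Rmax (maxabs m' a) (Rabs (a m')) end.
Fixpoint sumabs (m : nat) (a : nat -> R) : R :=
  match m with O => 0 | S m' => sumabs m' a + Rabs (a m') end.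

Definition equiv_c0 (sn : (nat -> R) -> R) : Prop :=
  exists c C, 0 < c /\ 0 < C /\ forall m a,
    c * maxabs m a <= sn (trunc m a) <= C * maxabs m a.

Definition equiv_l1 (sn : (nat -> R) -> R) : Prop :=
  exists c C, 0 < c /\ 0 < C /\ forall m a,
    c * sumabs m a <= sn (trunc m a) <= C * sumabs m a.

Definition dual_admits_l1_ksm (X : Banach) (k : nat) : Prop :=
  exists f : list nat -> (X -> R),
    (forall s, ksubN k s -> is_blf X (f s)) /\
    exists sn, is_seminorm_coord sn /\
      gen_spreading_model (fun _ => 0) (fun g h y => g y + h y)
        (fun c g y => c * g y) (dnorm X) k f sn /\
      equiv_l1 sn.

(* Main.v *)
Require Import Defs.
From Stdlib Require Import Reals Lra Lia List Sorted Arith ClassicalEpsilon.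
From Stdlib Require Import FunctionalExtensionality Cantor.
From mathcomp Require boolp classical_sets.
Import ListNotations.
Open Scope R_scope.

(** Let [(x_s)] generate a spreading model equivalent to the basis of [c_0], and let [f_s] be
    a functional of norm at most one with [f_s (x_s) = ||x_s||] (Hahn-Banach).  By the [c_0]
    upper estimate, [sum_j |f_{s_p} (x_{s_j})|] is bounded along plegma families
    [(s_j)] independently of their length.  Ramsey's theorem for plegma pairs then forces
    [f_s (x_t)] and [f_t (x_s)] to tend to [0] along plegma pairs [(s, t)], so testing
    [sum_j a_j f_{s_j}] on [sum_j sgn (a_j) x_{s_j}] gives a lower [l_1] estimate.  A further
    application of Ramsey's theorem makes all the norms [||sum_j a_j f_{s_j}||] converge. *)

(** A single large value [f_s (x_t)] contradicts nothing; a contradiction needs one functional with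
    large values at all other members of a long plegma family. Only the first and the last member
    stand in the same plegma order to all the others. Hence the two orders of a pair are decided
    separately: the row of the first functional rules out one kind of large value, the row of the
    last functional the other.

    In the lower estimate [m] off-diagonal errors add up, so the smallness required of them depends
    on the length [m]. This is harmless: the resulting [l_1] constant does not depend on [m], and
    the limit seminorm only sees families that start far out.

    One infinite set can settle only countably many questions, each from some point on. Norms are
    therefore compared with rational thresholds at rational coefficients; Lipschitz dependence on
    the coefficients gives the real ones, and finite nets give the uniformity that a spreading model
    demands. *)

(** * Infinite sets of integers as strictly increasing enumerations *)

Lemma strictly_incr_lt (M : nat -> nat) (i j : nat) :
  strictly_incr M -> (i < j)%nat -> (M i < M j)%nat.
Proof.
  intros HM; induction 1 as [|j _ IH]; [apply HM|].
  specialize (HM j); lia.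
Qed.

Lemma strictly_incr_le (M : nat -> nat) (i j : nat) :
  strictly_incr M -> (i <= j)%nat -> (M i <= M j)%nat.
Proof.
  intros HM Hij; destruct (Nat.eq_dec i j) as [->|Hne]; [lia|].
  assert (M i < M j)%nat by (apply strictly_incr_lt; [assumption|lia]); lia.
Qed.

Lemma strictly_incr_lt_inv (M : nat -> nat) (i j : nat) :
  strictly_incr M -> (M i < M j)%nat -> (i < j)%nat.
Proof.
  intros HM H; destruct (le_lt_dec j i) as [Hji|]; [|assumption].
  apply (strictly_incr_le M) in Hji; [lia|assumption].
Qed.

Lemma strictly_incr_ge_id (M : nat -> nat) (n : nat) :
  strictly_incr M -> (n <= M n)%nat.
Proof.
  intros HM; induction n as [|n IH]; [lia|]. specialize (HM n); lia.
Qed.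

Lemma strictly_incr_comp (M h : nat -> nat) :
  strictly_incr M -> strictly_incr h -> strictly_incr (fun i => M (h i)).
Proof. intros HM Hh i; apply strictly_incr_lt; auto. Qed.

Lemma strictly_incr_above (g : nat -> nat) :
  exists h, strictly_incr h /\ forall n, (g n <= h n)%nat.
Proof.
  exists (fix h n := match n with O => g O | S n' => Nat.max (S (h n')) (g (S n')) end).
  split; intros n; [|destruct n]; lia.
Qed.

Lemma strictly_incr_extract (c : nat -> Prop) :
  (forall N, exists n, (N <= n)%nat /\ c n) ->
  exists h, strictly_incr h /\ forall i, c (h i).
Proof.
  intros Hc.
  destruct (choice (fun N n => (N <= n)%nat /\ c n) Hc) as [g Hg].
  exists (fix h n := match n with O => g O | S n' => g (S (h n')) end).
  split; intros n.
  - apply (Hg (S _)).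
  - destruct n; apply Hg.
Qed.

Lemma ksub_incl (k : nat) (M M' : nat -> nat) (s : list nat) :
  (forall i, exists j, M i = M' j) -> ksub k M s -> ksub k M' s.
Proof.
  intros Hin (Hl & Hs & Hr); repeat split; try assumption.
  revert Hr; apply Forall_impl; intros n [i Hi].
  destruct (Hin i) as [j Hj]; exists j; congruence.
Qed.

Lemma ksub_comp (k : nat) (M h : nat -> nat) (s : list nat) :
  ksub k (fun i => M (h i)) s -> ksub k M s.
Proof. apply ksub_incl; intros i; now exists (h i). Qed.

Lemma sorted_lt_head (x : nat) (u : list nat) :
  Sorted lt (x :: u) -> Forall (fun n => (x < n)%nat) u.
Proof.
  intros H; apply Sorted_extends in H; [assumption|].
  intros a b c; apply Nat.lt_trans.
Qed.

Lemma sorted_nth_lt (u : list nat) (p : nat) :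
  Sorted lt u -> (S p < length u)%nat -> (nth p u 0 < nth (S p) u 0)%nat.
Proof.
  intros H; revert p; induction H as [|x u Hu IH Hd]; simpl; intros p Hp; [lia|].
  destruct p as [|p].
  - destruct u as [|y u]; simpl in *; [lia|]. now inversion Hd.
  - apply IH; lia.
Qed.

Lemma sorted_of_nth_lt (u : list nat) :
  (forall p, (S p < length u)%nat -> (nth p u 0 < nth (S p) u 0)%nat) -> Sorted lt u.
Proof.
  induction u as [|x u IH]; intros H; constructor.
  - apply IH; intros p Hp; apply (H (S p)); simpl; lia.
  - destruct u as [|y u]; constructor; apply (H 0%nat); simpl; lia.
Qed.

(** * Ramsey's theorem *)

(* Diagonal intersection: the n-th term D n is the head of a sequence, and a good
   refinement M' of its tail contains every later term of D. *)
Lemma fusion (G : nat -> nat -> (nat -> nat) -> Prop) :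
  (forall n M, strictly_incr M ->
     exists h, strictly_incr h /\ G n (M 0%nat) (fun i => M (S (h i)))) ->
  forall M, strictly_incr M ->
  exists h, strictly_incr h /\
    forall n, exists M', strictly_incr M' /\ G n (M (h n)) M' /\
      forall i, (n < i)%nat -> exists j, M (h i) = M' j.
Proof.
  intros Hstep M HM.
  (* [choice] needs a total relation, so a refinement is picked for every sequence, under the guard
     that it is increasing. *)
  destruct (choice
    (fun (p : nat * (nat -> nat)) h => strictly_incr (snd p) ->
       strictly_incr h /\ G (fst p) (snd p 0%nat) (fun i => snd p (S (h i)))))
    as [H HH].
  { intros [n N]; simpl.
    destruct (excluded_middle_informative (strictly_incr N)) as [HN|HN].
    - destruct (Hstep n N HN) as [h Hh]; exists h; auto.
    - exists (fun i => i); tauto. }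
  (* [idx n] enumerates the positions in [M] that survive [n] rounds; each round discards the head
     and refines the tail, so the heads [idx n 0] increase. *)
  pose (idx := fix idx n : nat -> nat := match n with
     | O => fun i => i
     | S n' => fun i => idx n' (S (H (n', fun i => M (idx n' i)) i)) end).
  assert (Hidx : forall n, strictly_incr (idx n)).
  { induction n as [|n IH]; [intros i; simpl; lia|].
    assert (HMn : strictly_incr (fun i => M (idx n i))) by now apply strictly_incr_comp.
    destruct (HH (n, fun i => M (idx n i)) HMn) as [Hh _].
    intros i; simpl; apply strictly_incr_lt; [assumption|]. specialize (Hh i); lia. }
  assert (Hnest : forall n i, (n < i)%nat -> forall j, exists j', idx i j = idx (S n) j').
  { intros n i; induction 1 as [|i _ IH]; intros j; [now exists j|].
    simpl; destruct (IH (S (H (i, fun i0 => M (idx i i0)) j))) as [j' Hj'].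
    exists j'; exact Hj'. }
  exists (fun n => idx n 0%nat); split.
  { intros n; simpl; apply strictly_incr_lt; [apply Hidx|lia]. }
  intros n; exists (fun i => M (idx (S n) i)); split; [|split].
  - apply strictly_incr_comp; [assumption|apply Hidx].
  - apply (HH (n, fun i => M (idx n i))).
    apply (strictly_incr_comp M); auto.
  - intros i Hi; destruct (Hnest n i Hi 0%nat) as [j Hj]; exists j; congruence.
Qed.

Definition homogeneous (d : nat) (P : list nat -> Prop) (M : nat -> nat) : Prop :=
  (forall u, ksub d M u -> P u) \/ (forall u, ksub d M u -> ~ P u).

(** Carries a decision made on the refinement [M'] back to the diagonal set [D]: elements of [D]
    above [D n] have index larger than [n], and these are the ones known to lie in [M']. *)
Lemma ksub_tail (d n : nat) (D M' : nat -> nat) (u : list nat) :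
  strictly_incr D ->
  (forall i, (n < i)%nat -> exists j, D i = M' j) ->
  ksub d D u -> Forall (fun m => (D n < m)%nat) u -> ksub d M' u.
Proof.
  intros HD Hin (Hl & Hs & Hr) Hgt; repeat split; try assumption.
  rewrite Forall_forall in *; intros m Hm.
  destruct (Hr m Hm) as [i Hi]; specialize (Hgt m Hm).
  destruct (Hin i) as [j Hj]; [|exists j; congruence].
  apply (strictly_incr_lt_inv D); [assumption|lia].
Qed.

(** By fusion and the induction hypothesis, the colour of a set comes to depend on its least element
    only. Either infinitely many heads have the first colour and are extracted, or all heads from
    some [N] on have the second. *)
Theorem ramsey (d : nat) (P : list nat -> Prop) (M : nat -> nat) :
  strictly_incr M ->
  exists h, strictly_incr h /\ homogeneous d P (fun i => M (h i)).
Proof.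
  revert P M; induction d as [|d IH]; intros P M HM.
  { exists (fun i => i); split; [intros i; lia|].
    destruct (classic (P [])) as [H|H]; [left|right];
      intros u (Hl & _); apply length_zero_iff_nil in Hl; now subst. }
  destruct (fusion (fun _ x M' => homogeneous d (fun u => P (x :: u)) M')) with (M := M)
    as (h & Hh & HG); [|assumption|].
  { intros _ N HN. apply (IH _ (fun i => N (S i))). intros i; apply HN. }
  set (D := fun i => M (h i)) in *.
  assert (HD : strictly_incr D) by now apply (strictly_incr_comp M h).
  pose (c n := forall u, ksub d D u -> Forall (fun m => (D n < m)%nat) u -> P (D n :: u)).
  assert (Hc : forall n, c n \/
     forall u, ksub d D u -> Forall (fun m => (D n < m)%nat) u -> ~ P (D n :: u)).
  { intros n; destruct (HG n) as (M' & _ & [H|H] & Hin); [left|right];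
      intros u Hu Hgt; apply H; now apply (ksub_tail d n D). }
  assert (Hcons : forall g, strictly_incr g -> forall u, ksub (S d) (fun i => D (g i)) u ->
     exists i v, u = D (g i) :: v /\ ksub d D v /\ Forall (fun m => (D (g i) < m)%nat) v).
  { intros g Hg u (Hl & Hs & Hr); destruct u as [|x u]; simpl in Hl; [lia|].
    inversion Hr as [|? ? [i Hi] Hr']; subst; exists i, u; repeat split.
    - lia.
    - now inversion Hs.
    - revert Hr'; apply Forall_impl; intros m [j Hj]; now exists (g j).
    - now apply sorted_lt_head. }
  destruct (classic (forall N, exists n, (N <= n)%nat /\ c n)) as [Hinf|Hfin].
  - destruct (strictly_incr_extract c Hinf) as (g & Hg & Hcg).
    exists (fun i => h (g i)); split; [now apply (strictly_incr_comp h g)|].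
    left; intros u Hu; destruct (Hcons g Hg u Hu) as (i & v & -> & Hv & Hgt).
    now apply Hcg.
  - apply not_all_ex_not in Hfin; destruct Hfin as [N HN].
    assert (Hg : strictly_incr (fun i => (N + i)%nat)) by (intros i; lia).
    exists (fun i => h (N + i)%nat); split; [now apply (strictly_incr_comp h (fun i => (N + i)%nat))|].
    right; intros u Hu; destruct (Hcons _ Hg u Hu) as (i & v & -> & Hv & Hgt).
    destruct (Hc (N + i)%nat) as [H|H]; [|now apply H].
    exfalso; apply HN; exists (N + i)%nat; split; [lia|assumption].
Qed.

(** Infinitely many properties cannot in general all be decided outright on one infinite set; fusion
    decides the [n]-th one beyond the [n]-th term, which is enough for eventual statements. *)
Lemma ramsey_countable (d : nat -> nat) (P : nat -> list nat -> Prop) (M : nat -> nat) :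
  strictly_incr M ->
  exists h, strictly_incr h /\ forall n,
    (forall u, ksub (d n) (fun i => M (h i)) u ->
       Forall (fun m => (M (h n) < m)%nat) u -> P n u) \/
    (forall u, ksub (d n) (fun i => M (h i)) u ->
       Forall (fun m => (M (h n) < m)%nat) u -> ~ P n u).
Proof.
  intros HM.
  destruct (fusion (fun n _ M' => homogeneous (d n) (P n) M')) with (M := M)
    as (h & Hh & HG); [|assumption|].
  { intros n N HN; apply (ramsey (d n) (P n) (fun i => N (S i))). intros i; apply HN. }
  exists h; split; [assumption|]; intros n.
  destruct (HG n) as (M' & _ & [H|H] & Hin); [left|right];
    intros u Hu Hgt; apply H; apply (ksub_tail (d n) n (fun i => M (h i)));
    auto using strictly_incr_comp.
Qed.

(** * The Hahn-Banach theorem *)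

Lemma badd_cancel_l (X : Banach) (x y z : X) : badd X x y = badd X x z -> y = z.
Proof.
  intros H; apply (f_equal (badd X (bopp X x))) in H.
  rewrite !badd_assoc, (badd_comm X (bopp X x)), badd_opp in H.
  now rewrite !(badd_comm X (bzero X)), !badd_0 in H.
Qed.

Lemma bscal_0_l (X : Banach) (x : X) : bscal X 0 x = bzero X.
Proof.
  apply (badd_cancel_l X (bscal X 0 x)).
  now rewrite badd_0, <- bscal_distr_scal, Rplus_0_l.
Qed.

Lemma bscal_0_r (X : Banach) (a : R) : bscal X a (bzero X) = bzero X.
Proof. now rewrite <- (bscal_0_l X (bzero X)), bscal_assoc, Rmult_0_r. Qed.

Lemma bopp_scal (X : Banach) (x : X) : bopp X x = bscal X (-1) x.
Proof.
  apply (badd_cancel_l X x); rewrite badd_opp.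
  rewrite <- (bscal_1 X x) at 1; rewrite <- bscal_distr_scal.
  now replace (1 + -1) with 0 by ring; rewrite bscal_0_l.
Qed.

Lemma badd_swap (X : Banach) (a b c d : X) :
  badd X (badd X a b) (badd X c d) = badd X (badd X a c) (badd X b d).
Proof.
  rewrite <- !badd_assoc; f_equal. rewrite !badd_assoc; f_equal. apply badd_comm.
Qed.

Lemma bnorm_0 (X : Banach) : bnorm X (bzero X) = 0.
Proof. rewrite <- (bscal_0_l X (bzero X)), bnorm_scal, Rabs_R0; ring. Qed.

Lemma bnorm_opp (X : Banach) (x : X) : bnorm X (bopp X x) = bnorm X x.
Proof. rewrite bopp_scal, bnorm_scal, Rabs_left; lra. Qed.

Lemma bnorm_ge0 (X : Banach) (x : X) : 0 <= bnorm X x.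
Proof.
  pose proof (bnorm_triangle X x (bopp X x)) as H.
  rewrite badd_opp, bnorm_0, bnorm_opp in H; lra.
Qed.

Lemma glb_exists {I : Type} (P : I -> Prop) (F : I -> R) (b : R) :
  (exists i, P i) -> (forall i, P i -> b <= F i) ->
  exists r, (forall i, P i -> r <= F i) /\
            (forall r', (forall i, P i -> r' <= F i) -> r' <= r).
Proof.
  intros [i0 H0] Hb.
  destruct (completeness (fun t => exists i, P i /\ t = - F i)) as [r [Hu Hl]].
  - exists (- b); intros t (i & Hi & ->); specialize (Hb i Hi); lra.
  - exists (- F i0), i0; auto.
  - exists (- r); split.
    + intros i Hi; assert (- F i <= r) by (apply Hu; eauto); lra.
    + intros r' Hr'; assert (r <= - r'); [|lra].
      apply Hl; intros t (i & Hi & ->); specialize (Hr' i Hi); lra.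
Qed.

(** Homogeneity is stated as an inequality because this form is easy to check for infima;
    [sublinear_scal] recovers equality by scaling back with [/ t]. *)
Definition sublinear (X : Banach) (p : X -> R) : Prop :=
  (forall x y, p (badd X x y) <= p x + p y) /\
  (forall t x, 0 < t -> p (bscal X t x) <= t * p x).

Section Sublinear.
Context (X : Banach) (p : X -> R) (Hp : sublinear X p).

Lemma sublinear_scal (t : R) (x : X) : 0 < t -> p (bscal X t x) = t * p x.
Proof.
  destruct Hp as [_ Hh]; intros Ht; apply Rle_antisym; [now apply Hh|].
  assert (Hi : 0 < / t) by now apply Rinv_0_lt_compat.
  pose proof (Hh (/ t) (bscal X t x) Hi) as H.
  rewrite bscal_assoc, Rinv_l, bscal_1 in H by lra.
  apply (Rmult_le_compat_l t) in H; [|lra].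
  rewrite <- Rmult_assoc, Rinv_r in H by lra; lra.
Qed.

Lemma sublinear_0 : p (bzero X) = 0.
Proof.
  pose proof (sublinear_scal 2 (bzero X)) as H; rewrite bscal_0_r in H; lra.
Qed.

Lemma sublinear_opp (x : X) : - p (bopp X x) <= p x.
Proof.
  destruct Hp as [Ha _]; pose proof (Ha x (bopp X x)) as H.
  rewrite badd_opp, sublinear_0 in H; lra.
Qed.

Lemma sublinear_scal_nonneg (t : R) (x : X) : 0 <= t -> p (bscal X t x) = t * p x.
Proof.
  intros [Ht|<-]; [now apply sublinear_scal|]. rewrite bscal_0_l, sublinear_0; ring.
Qed.

(** [q x] is the infimum over [t >= 0] of [p (x + t y) - t p y]. The values [t = 0] and [t = 1] give
    the two bounds; admitting every [t] keeps [q] positively homogeneous. *)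
Lemma sublinear_reduce (y : X) :
  exists q, sublinear X q /\ (forall x, q x <= p x) /\
    forall x, q x <= p (badd X x y) - p y.
Proof.
  pose (F x t := p (badd X x (bscal X t y)) - t * p y).
  destruct (choice (fun x r => (forall t, 0 <= t -> r <= F x t) /\
     (forall r', (forall t, 0 <= t -> r' <= F x t) -> r' <= r))) as [q Hq].
  { intros x; apply (glb_exists (fun t => 0 <= t) (F x) (- p (bopp X x))).
    - exists 0; lra.
    - intros t Ht; unfold F; destruct Hp as [Ha _].
      pose proof (Ha (badd X x (bscal X t y)) (bopp X x)) as H.
      rewrite (badd_comm X x), <- badd_assoc, badd_opp, badd_0 in H.
      rewrite sublinear_scal_nonneg in H by assumption.
      rewrite (badd_comm X x); lra. }
  exists q; split; [split|split].
  - intros x1 x2.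
    (* The parameter [t1 + t2] is admissible for [x1 + x2]; the infimum is then taken over [t2] and
       [t1] in turn. *)
    assert (H : forall t1, 0 <= t1 -> q (badd X x1 x2) - q x2 <= F x1 t1).
    { intros t1 H1.
      assert (q (badd X x1 x2) - F x1 t1 <= q x2); [|lra].
      apply Hq; intros t2 H2.
      assert (q (badd X x1 x2) <= F (badd X x1 x2) (t1 + t2)) by (apply Hq; lra).
      unfold F in *; rewrite bscal_distr_scal, badd_swap in H.
      destruct Hp as [Ha _].
      specialize (Ha (badd X x1 (bscal X t1 y)) (badd X x2 (bscal X t2 y))); lra. }
    apply Hq in H; lra.
  - intros s x Hs.
    assert (H : q (bscal X s x) / s <= q x).
    { apply Hq; intros t Ht; apply (Rmult_le_reg_l s); [assumption|].
      replace (s * (q (bscal X s x) / s)) with (q (bscal X s x)) by (field; lra).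
      apply Rle_trans with (F (bscal X s x) (s * t)).
      - apply Hq; apply Rmult_le_pos; lra.
      - unfold F; rewrite <- bscal_assoc, <- bscal_distr_vec, sublinear_scal by assumption.
        lra. }
    apply (Rmult_le_compat_l s) in H; [|lra].
    replace (s * (q (bscal X s x) / s)) with (q (bscal X s x)) in H by (field; lra); lra.
  - intros x; destruct (Hq x) as [H _]; specialize (H 0 (Rle_refl 0)).
    unfold F in H; rewrite bscal_0_l, badd_0 in H; lra.
  - intros x; destruct (Hq x) as [H _]; specialize (H 1 Rle_0_1).
    unfold F in H; rewrite bscal_1 in H; lra.
Qed.

End Sublinear.

(** Zorn's lemma applies because every sublinear [q] below [p] satisfies [- p (- x) <= q x], so
    pointwise infima along chains are finite. *)
Lemma minimal_sublinear (X : Banach) (p : X -> R) :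
  sublinear X p ->
  exists q, sublinear X q /\ (forall x, q x <= p x) /\
    forall q', sublinear X q' -> (forall x, q' x <= q x) -> forall x, q x <= q' x.
Proof.
  intros Hp.
  pose (T := {q : X -> R | sublinear X q /\ forall x, q x <= p x}).
  (* The order is reversed, so that the maximal element of Zorn's lemma is a minimal functional and
     the upper bound of a chain is its infimum. *)
  pose (Rel (q q' : T) := boolp.asbool (forall x, proj1_sig q' x <= proj1_sig q x)).
  assert (HR : forall q q' : T, is_true (Rel q q') <->
     forall x, proj1_sig q' x <= proj1_sig q x).
  { intros q q'; split; intros H; [now apply boolp.asboolW in H|now apply boolp.asboolT]. }
  assert (p0 : T) by (exists p; split; [exact Hp|intros; lra]).
  destruct (@classical_sets.ZL_preorder T p0 Rel) as [[q [Hq Hqp]] Hmin].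
  - intros q; apply HR; intros x; lra.
  - intros q1 q2 q3 H12 H23; rewrite HR in *; intros x.
    specialize (H12 x); specialize (H23 x); lra.
  - intros A HA.
    destruct (classic (exists q, A q)) as [Hne|Hempty].
    2: { exists p0; intros q Hq; exfalso; eauto. }
    destruct (choice (fun x r => (forall q, A q -> r <= proj1_sig q x) /\
      (forall r', (forall q, A q -> r' <= proj1_sig q x) -> r' <= r))) as [m Hm].
    { intros x; apply (glb_exists A (fun q => proj1_sig q x) (- p (bopp X x)) Hne).
      intros [q [Hq Hqp]] _; simpl.
      pose proof (Hqp (bopp X x)); pose proof (sublinear_opp X q Hq x); lra. }
    assert (Hms : sublinear X m).
    { split.
      - intros x y.
        assert (H : forall q1, A q1 -> m (badd X x y) - m y <= proj1_sig q1 x).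
        { intros q1 H1.
          assert (m (badd X x y) - proj1_sig q1 x <= m y); [|lra].
          apply Hm; intros q2 H2.
          (* Subadditivity of the infimum needs one member that is below [q1] at [x] and below [q2]
             at [y]; in a chain the smaller of the two serves. *)
          assert (Hq : exists q, A q /\ proj1_sig q x <= proj1_sig q1 x
                                     /\ proj1_sig q y <= proj1_sig q2 y).
          { destruct (HA q1 q2 H1 H2) as [H|H]; rewrite HR in H;
              [exists q2|exists q1]; repeat split; auto; lra. }
          destruct Hq as (q & Hq & Hx & Hy).
          assert (m (badd X x y) <= proj1_sig q (badd X x y)) by now apply Hm.
          pose proof (proj1 (proj1 (proj2_sig q)) x y); lra. }
        apply Hm in H; lra.
      - intros t x Ht.
        assert (H : m (bscal X t x) / t <= m x).
        { apply Hm; intros q Hq; apply (Rmult_le_reg_l t); [assumption|].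
          replace (t * (m (bscal X t x) / t)) with (m (bscal X t x)) by (field; lra).
          apply Rle_trans with (proj1_sig q (bscal X t x)); [now apply Hm|].
          destruct q as [q [[Ha Hh] Hqp]]; simpl; now apply Hh. }
        apply (Rmult_le_compat_l t) in H; [|lra].
        replace (t * (m (bscal X t x) / t)) with (m (bscal X t x)) in H by (field; lra).
        lra. }
    assert (Hmp : forall x, m x <= p x).
    { intros x; destruct Hne as [q Hq].
      apply Rle_trans with (proj1_sig q x); [now apply Hm|].
      destruct q as [q [Hqs Hqp]]; apply Hqp. }
    exists (exist _ m (conj Hms Hmp)); intros q Hq; apply HR; intros x; simpl.
    now apply Hm.
  - exists q; split; [assumption|split; [assumption|]].
    intros q' Hq' Hle.
    assert (Hq'p : forall x, q' x <= p x)
      by (intros x; apply Rle_trans with (q x); auto).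
    specialize (Hmin (exist _ q' (conj Hq' Hq'p))); rewrite !HR in Hmin; now apply Hmin.
Qed.

(* A minimal sublinear functional is linear: reducing it in the direction [y] cannot
   make it smaller, which is superadditivity. *)
Theorem norming_functional (X : Banach) (x0 : X) :
  exists f, is_blf X f /\ (forall x, Rabs (f x) <= bnorm X x) /\ f x0 = bnorm X x0.
Proof.
  assert (Hn : sublinear X (bnorm X)).
  { split; [apply bnorm_triangle|]; intros t x Ht.
    rewrite bnorm_scal, Rabs_pos_eq; lra. }
  (* Reducing the norm towards [x0] beforehand forces [f (- x0) <= - ||x0||] for every [f] below
     [q], so the minimal functional norms [x0] with no extension from a subspace. *)
  destruct (sublinear_reduce X (bnorm X) Hn x0) as (q & Hq & Hqn & Hqx).
  destruct (minimal_sublinear X q Hq) as (f & Hf & Hfq & Hmin).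
  assert (Hadd : forall x y, f (badd X x y) = f x + f y).
  { intros x y; apply Rle_antisym; [apply Hf|].
    destruct (sublinear_reduce X f Hf y) as (g & Hg & Hgf & Hgy).
    specialize (Hmin g Hg Hgf x); specialize (Hgy x); lra. }
  assert (Hopp : forall x, f (bopp X x) = - f x).
  { intros x; pose proof (Hadd x (bopp X x)) as H.
    rewrite badd_opp, (sublinear_0 X f Hf) in H; lra. }
  assert (Hle : forall x, Rabs (f x) <= bnorm X x).
  { intros x; apply Rabs_le; split.
    - pose proof (Hfq (bopp X x)); pose proof (Hqn (bopp X x)).
      rewrite Hopp in *; rewrite bnorm_opp in *; lra.
    - pose proof (Hfq x); pose proof (Hqn x); lra. }
  exists f; repeat split; try assumption.
  - intros a x; destruct (Rle_lt_dec 0 a) as [Ha|Ha].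
    + now apply sublinear_scal_nonneg.
    + replace (bscal X a x) with (bopp X (bscal X (- a) x)).
      * rewrite Hopp, (sublinear_scal X f Hf) by lra; ring.
      * rewrite bopp_scal, bscal_assoc; f_equal; ring.
  - exists 1; intros x; specialize (Hle x); lra.
  - apply Rle_antisym.
    + specialize (Hle x0); pose proof (Rle_abs (f x0)); lra.
    + pose proof (Hqx (bopp X x0)) as H; rewrite badd_comm, badd_opp, bnorm_0 in H.
      pose proof (Hfq (bopp X x0)); rewrite Hopp in *; lra.
Qed.

(** * Plegma families *)

Lemma plegma_nth_lt (k m : nat) (ss : nat -> list nat) (i j j' : nat) :
  plegma k m ss -> (i < k)%nat -> (j < j')%nat -> (j' < m)%nat ->
  (nth i (ss j) 0 < nth i (ss j') 0)%nat.
Proof.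
  intros Hp Hi; induction 1 as [|j' _ IH]; intros Hm; [now apply Hp|].
  apply Nat.lt_trans with (nth i (ss j') 0%nat); [apply IH; lia|now apply Hp].
Qed.

Lemma plegma_nth_le (k m : nat) (ss : nat -> list nat) (i j j' : nat) :
  plegma k m ss -> (i < k)%nat -> (j <= j')%nat -> (j' < m)%nat ->
  (nth i (ss j) 0 <= nth i (ss j') 0)%nat.
Proof.
  intros Hp Hi Hj Hm; destruct (Nat.eq_dec j j') as [->|Hne]; [lia|].
  apply Nat.lt_le_incl, (plegma_nth_lt k m); auto; lia.
Qed.

(** * Properties that hold eventually along plegma families *)

Definition plegma_beyond (k : nat) (M : nat -> nat) (n m : nat) (ss : nat -> list nat) : Prop :=
  (forall j, (j < m)%nat -> ksub k M (ss j)) /\ plegma k m ss /\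
  (M n <= nth 0 (ss 0%nat) 0)%nat.

(** For increasing [M] and positive [k] and [m] these properties form a proper filter, so limits
    along plegma families behave like ordinary limits. *)
Definition plegma_eventually (k : nat) (M : nat -> nat) (m : nat)
   
    (Q : (nat -> list nat) -> Prop) : Prop :=
  exists n, forall ss, plegma_beyond k M n m ss -> Q ss.

Lemma plegma_beyond_weaken (k : nat) (M : nat -> nat) (n n' m : nat) (ss : nat -> list nat) :
  strictly_incr M -> (n' <= n)%nat -> plegma_beyond k M n m ss -> plegma_beyond k M n' m ss.
Proof.
  intros HM Hn (H1 & H2 & H3); split; [assumption|split; [assumption|]].
  pose proof (strictly_incr_le M n' n HM Hn); lia.
Qed.

(** In each coordinate the last set chosen is at most the last set of the whole family, and the
    first one chosen is at least the first; so the gaps between coordinates survive. *)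
Lemma plegma_beyond_sub (k : nat) (M : nat -> nat) (n m m' : nat)
    (ss : nat -> list nat) (g : nat -> nat) :
  (1 <= k)%nat -> (1 <= m')%nat ->
  (forall j, (S j < m')%nat -> (g j < g (S j))%nat) -> (g (pred m') < m)%nat ->
  plegma_beyond k M n m ss -> plegma_beyond k M n m' (fun j => ss (g j)).
Proof.
  intros Hk Hm' Hg Hgm (H1 & H2 & H3).
  assert (Hle : forall j, (j < m')%nat -> (g j <= g (pred m'))%nat).
  { intros j Hj.
    assert (Hd : forall d, (j + d < m')%nat -> (g j <= g (j + d))%nat).
    { induction d as [|d IH]; intros Hd; [now rewrite Nat.add_0_r|].
      rewrite Nat.add_succ_r in *; specialize (Hg (j + d)%nat Hd).
      assert (g j <= g (j + d))%nat by (apply IH; lia); lia. }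
    replace (pred m') with (j + (pred m' - j))%nat by lia; apply Hd; lia. }
  split; [|split; [intros i Hi; split|]].
  - intros j Hj; apply H1; specialize (Hle j Hj); lia.
  - intros j Hj; apply (plegma_nth_lt k m); auto.
    specialize (Hle (S j) Hj); lia.
  - intros HSi.
    pose proof (plegma_nth_le k m ss i (g (pred m')) (pred m) H2 Hi ltac:(lia) ltac:(lia)).
    pose proof (plegma_nth_le k m ss (S i) 0%nat (g 0%nat) H2 HSi ltac:(lia)).
    specialize (Hle 0%nat Hm'); destruct (H2 i Hi) as [_ H4]; specialize (H4 HSi); lia.
  - pose proof (plegma_nth_le k m ss 0%nat 0%nat (g 0%nat) H2 Hk ltac:(lia)).
    specialize (Hle 0%nat Hm'); lia.
Qed.

Lemma nth_map_seq {A : Type} (F : nat -> A) (n p : nat) (d : A) :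
  (p < n)%nat -> nth p (map F (seq 0 n)) d = F p.
Proof.
  intros Hp; rewrite nth_indep with (d' := F 0%nat)
    by now rewrite length_map, length_seq.
  now rewrite map_nth, seq_nth.
Qed.

Lemma plegma_beyond_exists (k : nat) (M : nat -> nat) (n m : nat) :
  strictly_incr M -> (1 <= k)%nat -> (1 <= m)%nat ->
  exists ss, plegma_beyond k M n m ss.
Proof.
  intros HM Hk Hm.
  (* The [i]-th coordinates of the [m] sets fill the [i]-th block of [m] consecutive terms of [M],
     counted from [M n]. *)
  exists (fun j => map (fun i => M (n + i * m + j)%nat) (seq 0 k)); repeat split.
  - now rewrite length_map, length_seq.
  - apply sorted_of_nth_lt; rewrite length_map, length_seq; intros p Hp.
    rewrite !nth_map_seq by lia; apply strictly_incr_lt; [assumption|nia].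
  - apply Forall_forall; intros x Hx; apply in_map_iff in Hx.
    destruct Hx as (i & <- & _); eauto.
  - intros j Hj; rewrite !nth_map_seq by lia; apply strictly_incr_lt; [assumption|lia].
  - intros Hi; rewrite !nth_map_seq by lia; apply strictly_incr_lt; [assumption|nia].
  - rewrite nth_map_seq by lia; apply strictly_incr_le; [assumption|lia].
Qed.

Lemma plegma_eventually_exists (k : nat) (M : nat -> nat) (m : nat)
    (Q : (nat -> list nat) -> Prop) :
  strictly_incr M -> (1 <= k)%nat -> (1 <= m)%nat -> plegma_eventually k M m Q -> exists ss, Q ss.
Proof.
  intros HM Hk Hm [n Hn]; destruct (plegma_beyond_exists k M n m HM Hk Hm) as [ss Hss].
  exists ss; auto.
Qed.

Lemma plegma_eventually_mono (k : nat) (M : nat -> nat) (m : nat)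
    (Q Q' : (nat -> list nat) -> Prop) :
  (forall ss, (forall j, (j < m)%nat -> ksub k M (ss j)) -> Q ss -> Q' ss) ->
  plegma_eventually k M m Q -> plegma_eventually k M m Q'.
Proof.
  intros H [n Hn]; exists n; intros ss Hss; apply H; [apply Hss|auto].
Qed.

Lemma plegma_eventually_and (k : nat) (M : nat -> nat) (m : nat)
    (Q Q' : (nat -> list nat) -> Prop) :
  strictly_incr M ->
  plegma_eventually k M m Q -> plegma_eventually k M m Q' ->
  plegma_eventually k M m (fun ss => Q ss /\ Q' ss).
Proof.
  intros HM [n Hn] [n' Hn']; exists (Nat.max n n'); intros ss Hss; split;
    [apply Hn|apply Hn']; apply (plegma_beyond_weaken k M (Nat.max n n')); auto; lia.
Qed.

Lemma plegma_eventually_sub (k : nat) (M : nat -> nat) (m m' : nat)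
    (Q : (nat -> list nat) -> Prop) :
  (1 <= k)%nat -> (1 <= m')%nat ->
  plegma_eventually k M m' Q ->
  plegma_eventually k M m (fun ss => forall g, (forall j, (S j < m')%nat -> (g j < g (S j))%nat) ->
    (g (pred m') < m)%nat -> Q (fun j => ss (g j))).
Proof.
  intros Hk Hm' [n Hn]; exists n; intros ss Hss g Hg Hgm; apply Hn.
  now apply (plegma_beyond_sub k M n m).
Qed.

(** * Ramsey's theorem for plegma families, by coding a family as one finite set *)

Lemma sorted_nth_ge_head (u : list nat) (p : nat) :
  Sorted lt u -> (p < length u)%nat -> (nth 0 u 0 <= nth p u 0)%nat.
Proof.
  intros Hu; induction p as [|p IH]; intros Hp; [lia|].
  pose proof (sorted_nth_lt u p Hu Hp); specialize (IH ltac:(lia)); lia.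
Qed.

(* A plegma family of [m] sets of size [k] is the same thing as a single set of size
   [k * m], whose element number [i * m + j] is the [i]-th element of the [j]-th set. *)
Definition plegma_join (k m : nat) (ss : nat -> list nat) : list nat :=
  map (fun p => nth (p / m) (ss (p mod m)) 0%nat) (seq 0 (k * m)).

Definition plegma_split (k m : nat) (u : list nat) (j : nat) : list nat :=
  map (fun i => nth (i * m + j) u 0%nat) (seq 0 k).

Lemma plegma_split_join (k m : nat) (ss : nat -> list nat) (j : nat) :
  (j < m)%nat -> length (ss j) = k -> plegma_split k m (plegma_join k m ss) j = ss j.
Proof.
  intros Hj Hl; apply nth_ext with (d := 0%nat) (d' := 0%nat).
  - unfold plegma_split; now rewrite length_map, length_seq.
  - unfold plegma_split at 1; rewrite length_map, length_seq; intros i Hi.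
    unfold plegma_split, plegma_join; rewrite !nth_map_seq by nia.
    rewrite Nat.div_add_l, Nat.div_small, Nat.add_0_r by lia.
    now rewrite Nat.add_comm, Nat.Div0.mod_add, Nat.mod_small.
Qed.

Lemma plegma_join_ksub (k : nat) (M : nat -> nat) (m : nat) (ss : nat -> list nat) :
  (forall j, (j < m)%nat -> ksub k M (ss j)) -> plegma k m ss ->
  ksub (k * m) M (plegma_join k m ss).
Proof.
  intros H1 H2; unfold plegma_join; repeat split.
  - now rewrite length_map, length_seq.
  - apply sorted_of_nth_lt; rewrite length_map, length_seq; intros p Hp.
    rewrite !nth_map_seq by lia.
    assert (Hm : (m <> 0)%nat) by (intros ->; lia).
    pose proof (Nat.div_mod_eq p m) as Hd; pose proof (Nat.mod_upper_bound p m Hm) as Hb.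
    set (q := (p / m)%nat) in *; set (r := (p mod m)%nat) in *.
    (* From [p] to [S p] one either wraps around to the next coordinate, which is the second plegma
       inequality, or moves to the next set in the same coordinate, which is the first. *)
    destruct (Nat.eq_dec (S r) m) as [He|He].
    + assert (HS : S p = (S q * m + 0)%nat) by nia.
      rewrite HS, Nat.div_add_l, Nat.Div0.div_0_l, Nat.add_0_r by lia.
      rewrite Nat.add_0_r, Nat.Div0.mod_mul.
      replace r with (pred m) by lia; apply H2; nia.
    + assert (HS : S p = (q * m + S r)%nat) by nia.
      rewrite HS, Nat.div_add_l, Nat.div_small, Nat.add_0_r by lia.
      rewrite Nat.add_comm, Nat.Div0.mod_add, Nat.mod_small by lia.
      apply H2; [nia|lia].
  - apply Forall_forall; intros x Hx; apply in_map_iff in Hx.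
    destruct Hx as (p & <- & Hp); apply in_seq in Hp.
    assert (Hm : (m <> 0)%nat) by (intros ->; lia).
    destruct (H1 (p mod m)%nat (Nat.mod_upper_bound p m Hm)) as (Hl & _ & Hr).
    rewrite Forall_forall in Hr; apply Hr, nth_In; rewrite Hl.
    apply Nat.Div0.div_lt_upper_bound; lia.
Qed.

(** Since [plegma_split] reproduces a family only at indices below its length, each [Q n] has to
    depend on the first [m n] sets alone. *)
Theorem plegma_ramsey (k : nat) (m : nat -> nat) (Q : nat -> (nat -> list nat) -> Prop)
    (M : nat -> nat) :
  (1 <= k)%nat -> (forall n, (1 <= m n)%nat) ->
  (forall n ss ss', (forall j, (j < m n)%nat -> ss j = ss' j) -> Q n ss -> Q n ss') ->
  strictly_incr M ->
  exists h, strictly_incr h /\ forall n,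
    plegma_eventually k (fun i => M (h i)) (m n) (Q n) \/
    plegma_eventually k (fun i => M (h i)) (m n) (fun ss => ~ Q n ss).
Proof.
  intros Hk Hm HQ HM.
  destruct (ramsey_countable (fun n => (k * m n)%nat)
    (fun n u => Q n (plegma_split k (m n) u)) M HM) as (h & Hh & Hhom).
  exists h; split; [assumption|]; intros n.
  set (D := fun i => M (h i)) in *.
  assert (HD : strictly_incr D) by now apply (strictly_incr_comp M h).
  (* The decision concerns sets strictly above [D n], hence families that start at [D (S n)] or
     later. *)
  assert (Hjoin : forall ss, plegma_beyond k D (S n) (m n) ss ->
     ksub (k * m n) D (plegma_join k (m n) ss) /\
     Forall (fun p => (D n < p)%nat) (plegma_join k (m n) ss) /\
     forall j, (j < m n)%nat -> plegma_split k (m n) (plegma_join k (m n) ss) j = ss j).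
  { intros ss (H1 & H2 & H3); specialize (Hm n).
    assert (Hu : ksub (k * m n) D (plegma_join k (m n) ss)) by now apply plegma_join_ksub.
    split; [assumption|split].
    - apply Forall_forall; intros x Hx; apply In_nth with (d := 0%nat) in Hx.
      destruct Hx as (p & Hp & <-); destruct Hu as (Hl & Hs & _).
      pose proof (sorted_nth_ge_head _ p Hs Hp) as Hge.
      unfold plegma_join at 1 in Hge; rewrite nth_map_seq in Hge by nia.
      rewrite Nat.Div0.div_0_l, Nat.Div0.mod_0_l in Hge; specialize (HD n); lia.
    - intros j Hj; apply plegma_split_join; [assumption|]. now apply H1. }
  destruct (Hhom n) as [H|H]; [left|right]; exists (S n); intros ss Hss;
    destruct (Hjoin ss Hss) as (Hu & Hgt & Hsp).
  - apply (HQ n (plegma_split k (m n) (plegma_join k (m n) ss))); auto.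
  - intros HQss; apply (H _ Hu Hgt); revert HQss; apply HQ; intros j Hj; symmetry; auto.
Qed.

(** * Finite sums *)

Fixpoint rsum (m : nat) (F : nat -> R) : R :=
  match m with O => 0 | S m' => rsum m' F + F m' end.

Lemma rsum_ext (m : nat) (F G : nat -> R) :
  (forall j, (j < m)%nat -> F j = G j) -> rsum m F = rsum m G.
Proof.
  induction m as [|m IH]; intros H; simpl; [reflexivity|].
  rewrite IH, H by auto; reflexivity.
Qed.

Lemma rsum_le (m : nat) (F G : nat -> R) :
  (forall j, (j < m)%nat -> F j <= G j) -> rsum m F <= rsum m G.
Proof.
  induction m as [|m IH]; intros H; simpl; [lra|].
  apply Rplus_le_compat; auto.
Qed.

Lemma rsum_plus (m : nat) (F G : nat -> R) :
  rsum m (fun j => F j + G j) = rsum m F + rsum m G.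
Proof. induction m as [|m IH]; simpl; [|rewrite IH]; ring. Qed.

Lemma rsum_scal (m : nat) (c : R) (F : nat -> R) :
  rsum m (fun j => c * F j) = c * rsum m F.
Proof. induction m as [|m IH]; simpl; [|rewrite IH]; ring. Qed.

Lemma rsum_const (m : nat) (c : R) : rsum m (fun _ => c) = INR m * c.
Proof. induction m as [|m IH]; [simpl; ring|]. rewrite S_INR; simpl; rewrite IH; ring. Qed.

Lemma rsum_abs (m : nat) (F : nat -> R) : Rabs (rsum m F) <= rsum m (fun j => Rabs (F j)).
Proof.
  induction m as [|m IH]; simpl; [rewrite Rabs_R0; lra|].
  pose proof (Rabs_triang (rsum m F) (F m)); lra.
Qed.

Lemma rsum_pad (m m' : nat) (F : nat -> R) :
  (m <= m')%nat -> (forall j, (m <= j)%nat -> F j = 0) -> rsum m' F = rsum m F.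
Proof.
  induction 1 as [|m' Hm IH]; intros H; simpl; [reflexivity|].
  rewrite IH, H by auto; ring.
Qed.

Lemma rsum_ge_except (m p : nat) (F : nat -> R) (e : R) :
  0 <= e -> (forall j, 0 <= F j) -> (forall j, (j < m)%nat -> j <> p -> e <= F j) ->
  INR m * e - e <= rsum m F.
Proof.
  intros He HF; induction m as [|m IH]; intros H; [simpl; lra|].
  rewrite S_INR; simpl; destruct (Nat.eq_dec m p) as [->|Hne].
  - assert (rsum p (fun _ => e) <= rsum p F)
      by (apply rsum_le; intros; apply H; lia).
    rewrite rsum_const in *; specialize (HF p); lra.
  - specialize (IH ltac:(intros; apply H; lia || assumption)).
    specialize (H m ltac:(lia) Hne); lra.
Qed.

Lemma rsum_single (m p : nat) (F : nat -> R) (e : R) :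
  0 <= e -> (p < m)%nat -> (forall j, (j < m)%nat -> j <> p -> Rabs (F j) <= e) ->
  Rabs (rsum m F - F p) <= INR m * e.
Proof.
  intros He; induction m as [|m IH]; intros Hp H; [lia|].
  rewrite S_INR; simpl; destruct (Nat.eq_dec m p) as [->|Hne].
  - replace (rsum p F + F p - F p) with (rsum p F) by ring.
    apply Rle_trans with (rsum p (fun _ => e)); [|rewrite rsum_const; lra].
    eapply Rle_trans; [apply rsum_abs|]; apply rsum_le; intros; apply H; lia.
  - specialize (IH ltac:(lia) ltac:(intros; apply H; lia || assumption)).
    specialize (H m ltac:(lia) Hne).
    replace (rsum m F + F m - F p) with ((rsum m F - F p) + F m) by ring.
    pose proof (Rabs_triang (rsum m F - F p) (F m)); lra.
Qed.

Lemma sumabs_rsum (m : nat) (a : nat -> R) : sumabs m a = rsum m (fun j => Rabs (a j)).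
Proof. induction m as [|m IH]; simpl; congruence. Qed.

Lemma maxabs_le1 (m : nat) (a : nat -> R) :
  (forall j, (j < m)%nat -> -1 <= a j <= 1) -> maxabs m a <= 1.
Proof.
  induction m as [|m IH]; intros H; simpl; [lra|].
  apply Rmax_lub; [auto|]. specialize (H m ltac:(lia)); apply Rabs_le; lra.
Qed.

Definition sgn (z : R) : R := if Rle_dec 0 z then 1 else -1.

Lemma sgn_range (z : R) : -1 <= sgn z <= 1.
Proof. unfold sgn; destruct (Rle_dec 0 z); lra. Qed.

Lemma sgn_mul (z : R) : sgn z * z = Rabs z.
Proof.
  unfold sgn; destruct (Rle_dec 0 z); [rewrite Rabs_pos_eq|rewrite Rabs_left]; lra.
Qed.

(** * A countable dense set of coefficient vectors *)

(** Ramsey's theorem is available for properties indexed by [nat], so rationals are coded by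
    integers; a difference of naturals in the numerator provides the sign. *)
Definition rat_code (p : nat) : R :=
  let (a, r) := Cantor.of_nat p in let (b, c) := Cantor.of_nat r in
  (INR a - INR b) / (INR c + 1).

Lemma rat_code_dense (r eps : R) : 0 < eps -> exists p, Rabs (rat_code p - r) < eps.
Proof.
  intros He.
  destruct (archimed_cor1 eps He) as (N & HN & HN0).
  destruct N as [|N]; [lia|]; rewrite S_INR in HN; pose proof (pos_INR N).
  (* [z / (N + 1)] exceeds [r] by at most [/ (N + 1)]; the positive and negative parts of [z] are
     the two naturals of the code. *)
  set (z := up (r * (INR N + 1))).
  destruct (archimed (r * (INR N + 1))) as [H1 H2]; fold z in H1, H2.
  exists (Cantor.to_nat (Z.to_nat z, Cantor.to_nat (Z.to_nat (- z), N))).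
  unfold rat_code; rewrite !Cantor.cancel_of_to, !INR_IZR_INZ, <- minus_IZR.
  replace (Z.of_nat (Z.to_nat z) - Z.of_nat (Z.to_nat (- z)))%Z with z by lia.
  rewrite <- INR_IZR_INZ.
  replace (IZR z / (INR N + 1) - r) with ((IZR z - r * (INR N + 1)) * / (INR N + 1))
    by (field; lra).
  assert (0 < / (INR N + 1)) by (apply Rinv_0_lt_compat; lra).
  rewrite Rabs_pos_eq; [nra|]. apply Rmult_le_pos; lra.
Qed.

Fixpoint seq_code (c j : nat) : nat :=
  match j with
  | O => fst (Cantor.of_nat c)
  | S j' => seq_code (snd (Cantor.of_nat c)) j'
  end.

Lemma seq_code_surj (m : nat) (v : nat -> nat) :
  exists c, forall j, (j < m)%nat -> seq_code c j = v j.
Proof.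
  revert v; induction m as [|m IH]; intros v; [exists 0%nat; lia|].
  destruct (IH (fun j => v (S j))) as [c Hc].
  exists (Cantor.to_nat (v 0%nat, c)); intros [|j] Hj; cbn [seq_code];
    rewrite Cantor.cancel_of_to; [reflexivity|]. apply Hc; lia.
Qed.

Lemma vec_code_dense (m : nat) (a : nat -> R) (eps : R) :
  0 < eps -> exists c, forall j, (j < m)%nat -> Rabs (rat_code (seq_code c j) - a j) < eps.
Proof.
  intros He.
  destruct (choice (fun j p => Rabs (rat_code p - a j) < eps)
    (fun j => rat_code_dense (a j) eps He)) as [v Hv].
  destruct (seq_code_surj m v) as [c Hc]; exists c; intros j Hj; rewrite Hc; auto.
Qed.

Lemma interval_net (eps : R) :
  0 < eps -> exists L, forall r, -1 <= r <= 1 -> exists b, In b L /\ Rabs (r - b) <= eps.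
Proof.
  intros He; destruct (archimed_cor1 eps He) as (N & HN & HN0).
  assert (HNR : 0 < INR N) by now apply lt_0_INR.
  assert (Hcov : forall n r, -1 <= r <= -1 + INR n / INR N -> exists i, (i <= n)%nat /\
     Rabs (r - (-1 + INR i / INR N)) <= / INR N).
  { assert (Hi : 0 < / INR N) by now apply Rinv_0_lt_compat.
    induction n as [|n IH]; intros r Hr.
    - exists 0%nat; split; [lia|]; simpl in *; apply Rabs_le; lra.
    - destruct (Rle_lt_dec r (-1 + INR n / INR N)) as [H|H].
      + destruct (IH r ltac:(lra)) as (i & Hin & Hri); exists i; split; [lia|assumption].
      + exists (S n); split; [lia|]; rewrite S_INR in *; apply Rabs_le.
        unfold Rdiv in *; lra. }
  exists (map (fun i => -1 + INR i / INR N) (seq 0 (S (2 * N)))); intros r Hr.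
  destruct (Hcov (2 * N)%nat r) as (i & Hi & Hri).
  - replace (INR (2 * N) / INR N) with 2; [lra|].
    rewrite mult_INR; simpl (INR 2); field; lra.
  - exists (-1 + INR i / INR N); split; [|lra].
    apply (in_map (fun i => -1 + INR i / INR N)), in_seq; lia.
Qed.

Lemma cube_net (m : nat) (eps : R) :
  0 < eps -> exists L : list (nat -> R), forall a, (forall j, (j < m)%nat -> -1 <= a j <= 1) ->
    exists b, In b L /\ forall j, (j < m)%nat -> Rabs (a j - b j) <= eps.
Proof.
  intros He; destruct (interval_net eps He) as [L1 H1].
  induction m as [|m [L HL]].
  - exists [fun _ => 0]; intros a _; exists (fun _ => 0); split; [now left|lia].
  - exists (flat_map (fun b => map (fun r j => if Nat.eqb j m then r else b j) L1) L).
    intros a Ha; destruct (HL a) as (b & Hb & Hab); [intros; apply Ha; lia|].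
    destruct (H1 (a m)) as (r & Hr & Har); [apply Ha; lia|].
    exists (fun j => if Nat.eqb j m then r else b j); split.
    + apply in_flat_map; exists b; split; [assumption|].
      apply (in_map (fun r j => if Nat.eqb j m then r else b j)); assumption.
    + intros j Hj; destruct (Nat.eqb_spec j m) as [->|Hne]; [assumption|].
      apply Hab; lia.
Qed.

(** * The dual norm *)

Section DualNorm.
Context (X : Banach).

(** [dnorm] is an [epsilon] term and is meaningful once a least upper bound exists; boundedness of
    [g] provides one. *)
Lemma dnorm_lub (g : X -> R) (C : R) :
  (forall x, Rabs (g x) <= C * bnorm X x) ->
  is_lub (fun t => exists x, bnorm X x <= 1 /\ t = Rabs (g x)) (dnorm X g).
Proof.
  intros HC; unfold dnorm; apply epsilon_spec.
  destruct (completeness (fun t => exists x, bnorm X x <= 1 /\ t = Rabs (g x))) as [r Hr].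
  - exists (Rabs C); intros t (x & Hx & ->); specialize (HC x).
    pose proof (bnorm_ge0 X x); pose proof (Rle_abs C); pose proof (Rabs_pos C); nra.
  - exists (Rabs (g (bzero X))), (bzero X); rewrite bnorm_0; split; [lra|reflexivity].
  - now exists r.
Qed.

Lemma dnorm_le (g : X -> R) (C r : R) :
  (forall x, Rabs (g x) <= C * bnorm X x) ->
  (forall x, bnorm X x <= 1 -> Rabs (g x) <= r) -> dnorm X g <= r.
Proof.
  intros HC Hr; apply (dnorm_lub g C HC); intros t (x & Hx & ->); auto.
Qed.

Lemma dnorm_ge (g : X -> R) (C : R) (x : X) :
  (forall x, Rabs (g x) <= C * bnorm X x) -> bnorm X x <= 1 -> Rabs (g x) <= dnorm X g.
Proof. intros HC Hx; apply (dnorm_lub g C HC); eauto. Qed.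

End DualNorm.

Lemma blf_0 (X : Banach) (g : X -> R) : is_blf X g -> g (bzero X) = 0.
Proof. intros (_ & Hs & _); rewrite <- (bscal_0_l X (bzero X)), Hs; ring. Qed.

Lemma blf_comb (X : Banach) (g : X -> R) (x : list nat -> X) (m : nat) (b : nat -> R)
    (ss : nat -> list nat) :
  is_blf X g ->
  g (comb (bzero X) (badd X) (bscal X) x m b ss) = rsum m (fun j => b j * g (x (ss j))).
Proof.
  intros Hg; induction m as [|m IH]; simpl; [now apply blf_0|].
  destruct Hg as (Ha & Hs & _); now rewrite Ha, Hs, IH.
Qed.

(** * Norms of combinations of contractive functionals *)

Section Combinations.
Context (X : Banach) (f : list nat -> X -> R).
Context (f_blf : forall s, is_blf X (f s)).
Context (f_le : forall s x, Rabs (f s x) <= bnorm X x).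

Definition dcomb (m : nat) (a : nat -> R) (ss : nat -> list nat) : X -> R :=
  comb (fun _ => 0) (fun g h y => g y + h y) (fun c g y => c * g y) f m a ss.

Lemma dcomb_eval (m : nat) (a : nat -> R) (ss : nat -> list nat) (y : X) :
  dcomb m a ss y = rsum m (fun j => a j * f (ss j) y).
Proof.
  unfold dcomb; induction m as [|m IH]; simpl; [reflexivity|now rewrite IH].
Qed.

Lemma dcomb_ext (m m' : nat) (a a' : nat -> R) (ss ss' : nat -> list nat) :
  (forall y, rsum m (fun j => a j * f (ss j) y) = rsum m' (fun j => a' j * f (ss' j) y)) ->
  dcomb m a ss = dcomb m' a' ss'.
Proof. intros H; apply functional_extensionality; intros y; now rewrite !dcomb_eval. Qed.

Lemma dcomb_bound (m : nat) (a : nat -> R) (ss : nat -> list nat) (y : X) :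
  Rabs (dcomb m a ss y) <= sumabs m a * bnorm X y.
Proof.
  rewrite dcomb_eval, sumabs_rsum; eapply Rle_trans; [apply rsum_abs|].
  rewrite Rmult_comm, <- rsum_scal; apply rsum_le; intros j _; rewrite Rabs_mult.
  specialize (f_le (ss j) y); pose proof (Rabs_pos (a j)); nra.
Qed.

Definition cnorm (m : nat) (a : nat -> R) (ss : nat -> list nat) : R :=
  dnorm X (dcomb m a ss).

Lemma cnorm_ge (m : nat) (a : nat -> R) (ss : nat -> list nat) (y : X) :
  bnorm X y <= 1 -> Rabs (dcomb m a ss y) <= cnorm m a ss.
Proof. apply dnorm_ge with (C := sumabs m a); apply dcomb_bound. Qed.

Lemma cnorm_le (m : nat) (a : nat -> R) (ss : nat -> list nat) (r : R) :
  (forall y, bnorm X y <= 1 -> Rabs (dcomb m a ss y) <= r) -> cnorm m a ss <= r.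
Proof. apply dnorm_le with (C := sumabs m a); apply dcomb_bound. Qed.

Lemma cnorm_ge0 (m : nat) (a : nat -> R) (ss : nat -> list nat) : 0 <= cnorm m a ss.
Proof.
  eapply Rle_trans; [apply Rabs_pos|]; apply (cnorm_ge m a ss (bzero X)).
  rewrite bnorm_0; lra.
Qed.

Lemma cnorm_le_sumabs (m : nat) (a : nat -> R) (ss : nat -> list nat) :
  cnorm m a ss <= sumabs m a.
Proof.
  apply cnorm_le; intros y Hy; eapply Rle_trans; [apply dcomb_bound|].
  assert (0 <= sumabs m a).
  { clear; induction m as [|m IH]; simpl; [lra|]. pose proof (Rabs_pos (a m)); lra. }
  nra.
Qed.

Lemma cnorm_triangle (m : nat) (a b : nat -> R) (ss : nat -> list nat) :
  cnorm m (fun j => a j + b j) ss <= cnorm m a ss + cnorm m b ss.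
Proof.
  apply cnorm_le; intros y Hy.
  replace (dcomb m (fun j => a j + b j) ss y) with (dcomb m a ss y + dcomb m b ss y).
  - eapply Rle_trans; [apply Rabs_triang|].
    now apply Rplus_le_compat; apply cnorm_ge.
  - rewrite !dcomb_eval, <- rsum_plus; apply rsum_ext; intros; ring.
Qed.

Lemma cnorm_scal_le (m : nat) (c : R) (a : nat -> R) (ss : nat -> list nat) :
  cnorm m (fun j => c * a j) ss <= Rabs c * cnorm m a ss.
Proof.
  apply cnorm_le; intros y Hy.
  replace (dcomb m (fun j => c * a j) ss y) with (c * dcomb m a ss y).
  - rewrite Rabs_mult; apply Rmult_le_compat_l; [apply Rabs_pos|now apply cnorm_ge].
  - rewrite !dcomb_eval, <- rsum_scal; apply rsum_ext; intros; ring.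
Qed.

Lemma cnorm_ext (m : nat) (a a' : nat -> R) (ss ss' : nat -> list nat) :
  (forall j, (j < m)%nat -> a j = a' j) -> (forall j, (j < m)%nat -> ss j = ss' j) ->
  cnorm m a ss = cnorm m a' ss'.
Proof.
  intros Ha Hs; unfold cnorm; f_equal; apply dcomb_ext; intros y; apply rsum_ext.
  intros j Hj; now rewrite Ha, Hs.
Qed.

Lemma cnorm_scal (m : nat) (c : R) (a : nat -> R) (ss : nat -> list nat) :
  cnorm m (fun j => c * a j) ss = Rabs c * cnorm m a ss.
Proof.
  apply Rle_antisym; [apply cnorm_scal_le|].
  destruct (Req_dec c 0) as [->|Hc].
  - rewrite Rabs_R0, Rmult_0_l; apply cnorm_ge0.
  - pose proof (cnorm_scal_le m (/ c) (fun j => c * a j) ss) as H.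
    rewrite (cnorm_ext m _ a ss ss) in H; [|intros; field; assumption|auto].
    rewrite Rabs_inv in H; pose proof (Rabs_pos_lt c Hc).
    apply (Rmult_le_compat_l (Rabs c)) in H; [|lra].
    rewrite <- Rmult_assoc, Rinv_r in H; lra.
Qed.

(** Contractivity of the functionals makes [cnorm] 1-Lipschitz for the [l_1] distance of
    coefficients, uniformly in [ss]. This uniformity drives all later approximations. *)
Lemma cnorm_close (m : nat) (a b : nat -> R) (ss : nat -> list nat) (e : R) :
  (forall j, (j < m)%nat -> Rabs (a j - b j) <= e) ->
  Rabs (cnorm m a ss - cnorm m b ss) <= INR m * e.
Proof.
  assert (Hone : forall a b, (forall j, (j < m)%nat -> Rabs (a j - b j) <= e) ->
     cnorm m a ss <= cnorm m b ss + INR m * e).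
  { clear a b; intros a b H.
    rewrite (cnorm_ext m a (fun j => b j + (a j - b j)) ss ss) by (intros; auto; ring).
    eapply Rle_trans; [apply cnorm_triangle|]; apply Rplus_le_compat_l.
    eapply Rle_trans; [apply cnorm_le_sumabs|].
    rewrite sumabs_rsum, <- rsum_const; now apply rsum_le. }
  intros H; apply Rabs_le; split.
  - assert (cnorm m b ss <= cnorm m a ss + INR m * e); [|lra].
    apply Hone; intros j Hj; rewrite Rabs_minus_sym; auto.
  - specialize (Hone a b H); lra.
Qed.

Lemma cnorm_pad (m m' : nat) (a : nat -> R) (ss : nat -> list nat) :
  (m <= m')%nat -> (forall j, (m <= j)%nat -> a j = 0) -> cnorm m' a ss = cnorm m a ss.
Proof.
  intros Hm Ha; unfold cnorm; f_equal; apply dcomb_ext; intros y.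
  apply rsum_pad; [assumption|]; intros j Hj; rewrite Ha by assumption; ring.
Qed.

(** On the signed test vector, the [j]-th functional retains its diagonal value, at least [c], up to
    an off-diagonal error of at most [m e <= c / 2]. Dividing the test vector by its norm bound [K]
    gives [c / (2 K)]. *)
Lemma cnorm_lower (x : list nat -> X) (m : nat) (a : nat -> R) (ss : nat -> list nat)
    (K c e : R) :
  0 < K ->
  (forall b, (forall j, (j < m)%nat -> -1 <= b j <= 1) ->
     bnorm X (comb (bzero X) (badd X) (bscal X) x m b ss) <= K) ->
  (forall j, (j < m)%nat -> c <= f (ss j) (x (ss j))) ->
  0 <= e -> INR m * e <= c / 2 ->
  (forall i j, (i < m)%nat -> (j < m)%nat -> i <> j -> Rabs (f (ss i) (x (ss j))) <= e) ->
  c / (2 * K) * sumabs m a <= cnorm m a ss.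
Proof.
  intros HK Hb Hdiag He Hme Hoff.
  set (b := fun j => sgn (a j)).
  set (y := comb (bzero X) (badd X) (bscal X) x m b ss).
  assert (Hy : bnorm X y <= K) by (apply Hb; intros; apply sgn_range).
  assert (Hval : c / 2 * sumabs m a <= dcomb m a ss y).
  { rewrite dcomb_eval, sumabs_rsum, <- rsum_scal; apply rsum_le; intros j Hj.
    unfold y; rewrite blf_comb by apply f_blf.
    set (F := fun i => b i * f (ss j) (x (ss i))).
    assert (HF : Rabs (rsum m F - F j) <= INR m * e).
    { apply rsum_single; auto; intros i Hi Hne; unfold F; rewrite Rabs_mult.
      assert (Rabs (b i) <= 1) by (apply Rabs_le, sgn_range).
      specialize (Hoff j i Hj Hi (not_eq_sym Hne)).
      pose proof (Rabs_pos (f (ss j) (x (ss i)))); nra. }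
    assert (Hj1 : a j * F j = Rabs (a j) * f (ss j) (x (ss j)))
      by (unfold F, b; rewrite <- sgn_mul; ring).
    assert (Hj2 : Rabs (a j * (rsum m F - F j)) <= Rabs (a j) * (c / 2)).
    { rewrite Rabs_mult; apply Rmult_le_compat_l; [apply Rabs_pos|lra]. }
    pose proof (Rle_abs (- (a j * (rsum m F - F j)))) as Hj3; rewrite Rabs_Ropp in Hj3.
    specialize (Hdiag j Hj); pose proof (Rabs_pos (a j)).
    replace (a j * rsum m F) with (a j * F j + a j * (rsum m F - F j)) by ring.
    rewrite Hj1; nra. }
  assert (Hi : 0 < / K) by now apply Rinv_0_lt_compat.
  assert (Hs : / K * dcomb m a ss y <= cnorm m a ss).
  { replace (/ K * dcomb m a ss y) with (dcomb m a ss (bscal X (/ K) y)).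
    - eapply Rle_trans; [apply Rle_abs|]; apply cnorm_ge.
      rewrite bnorm_scal, Rabs_pos_eq by lra.
      replace 1 with (/ K * K) by (field; lra); apply Rmult_le_compat_l; lra.
    - rewrite !dcomb_eval, <- rsum_scal; apply rsum_ext; intros j _.
      destruct (f_blf (ss j)) as (_ & Hs & _); rewrite Hs; ring. }
  apply (Rmult_le_compat_l (/ K)) in Hval; [|lra].
  replace (c / (2 * K) * sumabs m a) with (/ K * (c / 2 * sumabs m a)) by (field; lra).
  lra.
Qed.

End Combinations.

(** * The limit seminorm *)

Section Limit.
Context (X : Banach) (f : list nat -> X -> R).
Context (f_le : forall s x, Rabs (f s x) <= bnorm X x).
Context (k : nat) (hk : (1 <= k)%nat) (M : nat -> nat) (HM : strictly_incr M).
Context (dichotomy : forall m c q, (1 <= m)%nat ->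
  let Q ss := cnorm X f m (fun j => rat_code (seq_code c j)) ss < rat_code q in
  plegma_eventually k M m Q \/ plegma_eventually k M m (fun ss => ~ Q ss)).

Definition plegma_lim (m : nat) (a : nat -> R) (r : R) : Prop :=
  forall eps, 0 < eps -> plegma_eventually k M m (fun ss => Rabs (cnorm X f m a ss - r) <= eps).

(** The supremum [r] of the eventual lower bounds is the lower limit. If the norms were not
    eventually below a threshold slightly above [r], the dichotomy would give an eventual lower
    bound larger than [r]. *)
Lemma plegma_lim_exists (m : nat) (a : nat -> R) : (1 <= m)%nat -> exists r, plegma_lim m a r.
Proof.
  intros Hm.
  destruct (completeness (fun t => plegma_eventually k M m (fun ss => t <= cnorm X f m a ss)))
    as [r [Hub Hlub]].
  { exists (sumabs m a); intros t Ht; apply plegma_eventually_exists in Ht; try assumption.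
    destruct Ht as [ss Hss]; pose proof (cnorm_le_sumabs X f f_le m a ss); lra. }
  { exists 0, 0%nat; intros ss _; apply cnorm_ge0; assumption. }
  exists r; intros eps He.
  assert (Hlow : plegma_eventually k M m (fun ss => r - eps <= cnorm X f m a ss)).
  { apply NNPP; intros Hno.
    assert (r <= r - eps); [|lra].
    apply Hlub; intros t Ht; apply Rnot_lt_le; intros Hlt; apply Hno.
    revert Ht; apply plegma_eventually_mono; intros ss _ H; lra. }
  assert (Hup : plegma_eventually k M m (fun ss => cnorm X f m a ss <= r + eps)).
  { pose proof (pos_INR m).
    (* The rational threshold lies within [eps / 8] of [r + eps / 2], and rational coefficients cost
       another [eps / 8]; this stays below [r + eps] on one side and above [r + eps / 8] on the
       other. *)
    set (e := eps / 8 / (INR m + 1)).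
    assert (He' : 0 < e) by (apply Rdiv_lt_0_compat; lra).
    assert (Hme : INR m * e <= eps / 8).
    { assert (e * (INR m + 1) = eps / 8) by (unfold e; field; lra). nra. }
    destruct (vec_code_dense m a e He') as [c Hc].
    destruct (rat_code_dense (r + eps / 2) (eps / 8) ltac:(lra)) as [q Hq].
    apply Rabs_def2 in Hq.
    assert (Hclose : forall ss, Rabs (cnorm X f m (fun j => rat_code (seq_code c j)) ss
                                 - cnorm X f m a ss) <= eps / 8).
    { intros ss; eapply Rle_trans; [|exact Hme]; apply cnorm_close; [assumption|].
      intros j Hj; left; auto. }
    destruct (dichotomy m c q Hm) as [H1|H1].
    - revert H1; apply plegma_eventually_mono; intros ss _ H1; specialize (Hclose ss).
      rewrite Rabs_minus_sym in Hclose.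
      eapply Rle_trans in Hclose; [|apply Rle_abs]; lra.
    - exfalso; assert (r + eps / 8 <= r); [|lra].
      apply Hub; revert H1; apply plegma_eventually_mono; intros ss _ H1; specialize (Hclose ss).
      apply Rnot_lt_le in H1; eapply Rle_trans in Hclose; [|apply Rle_abs]; lra. }
  generalize (plegma_eventually_and k M m _ _ HM Hlow Hup); apply plegma_eventually_mono.
  intros ss _ [H1 H2]; apply Rabs_le; lra.
Qed.

Lemma plegma_lim_pad (m m' : nat) (a : nat -> R) (r : R) :
  (1 <= m)%nat -> (m <= m')%nat -> (forall j, (m <= j)%nat -> a j = 0) ->
  plegma_lim m a r -> plegma_lim m' a r.
Proof.
  intros Hm Hmm' Ha Hlim eps He.
  generalize (plegma_eventually_sub k M m' m _ hk Hm (Hlim eps He)); apply plegma_eventually_mono.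
  intros ss _ Hss; rewrite (cnorm_pad X f m m') by assumption.
  apply (Hss (fun j => j)); intros; lia.
Qed.

Lemma plegma_lim_unique (m : nat) (a : nat -> R) (r r' : R) :
  (1 <= m)%nat -> plegma_lim m a r -> plegma_lim m a r' -> r = r'.
Proof.
  intros Hm Hr Hr'; apply cond_eq; intros eps He.
  generalize (plegma_eventually_and k M m _ _ HM (Hr (eps / 3) ltac:(lra)) (Hr' (eps / 3) ltac:(lra))).
  intros H; apply plegma_eventually_exists in H; try assumption; destruct H as (ss & H1 & H2).
  rewrite Rabs_minus_sym in H1.
  replace (r - r') with ((r - cnorm X f m a ss) + (cnorm X f m a ss - r')) by ring.
  eapply Rle_lt_trans; [apply Rabs_triang|lra].
Qed.

(** A coordinate sequence carries no length, so [m] is quantified inside the choice; by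
    [plegma_lim_pad] and [plegma_lim_unique] the value does not depend on it. *)
Definition lim_norm (a : nat -> R) : R :=
  epsilon (inhabits 0) (fun r => exists m, (1 <= m)%nat /\
    (forall j, (m <= j)%nat -> a j = 0) /\ plegma_lim m a r).

Lemma lim_norm_spec (m : nat) (a : nat -> R) :
  (1 <= m)%nat -> (forall j, (m <= j)%nat -> a j = 0) -> plegma_lim m a (lim_norm a).
Proof.
  intros Hm Ha.
  destruct (plegma_lim_exists m a Hm) as [r Hr].
  assert (Hsp : exists m', (1 <= m')%nat /\ (forall j, (m' <= j)%nat -> a j = 0) /\
     plegma_lim m' a (lim_norm a)).
  { unfold lim_norm; apply epsilon_spec; eauto. }
  destruct Hsp as (m' & Hm' & Ha' & Hlim).
  replace (lim_norm a) with r; [assumption|].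
  apply (plegma_lim_unique (Nat.max m m') a); [lia| |].
  - apply (plegma_lim_pad m); auto; lia.
  - apply (plegma_lim_pad m'); auto; lia.
Qed.

Lemma fin_supp_pos (a : nat -> R) :
  fin_supp a -> exists m, (1 <= m)%nat /\ forall j, (m <= j)%nat -> a j = 0.
Proof. intros [N HN]; exists (S N); split; [lia|]; intros j Hj; apply HN; lia. Qed.

Lemma plegma_lim_ge (m : nat) (a : nat -> R) (r t : R) :
  (1 <= m)%nat -> plegma_lim m a r ->
  plegma_eventually k M m (fun ss => t <= cnorm X f m a ss) -> t <= r.
Proof.
  intros Hm Hr Ht; apply le_epsilon; intros eps He.
  generalize (plegma_eventually_and k M m _ _ HM (Hr eps He) Ht); intros H.
  apply plegma_eventually_exists in H; try assumption; destruct H as (ss & H1 & H2).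
  eapply Rle_trans in H1; [|apply Rle_abs]; lra.
Qed.

Lemma plegma_lim_le (m : nat) (a : nat -> R) (r t : R) :
  (1 <= m)%nat -> plegma_lim m a r ->
  plegma_eventually k M m (fun ss => cnorm X f m a ss <= t) -> r <= t.
Proof.
  intros Hm Hr Ht; apply le_epsilon; intros eps He.
  generalize (plegma_eventually_and k M m _ _ HM (Hr eps He) Ht); intros H.
  apply plegma_eventually_exists in H; try assumption; destruct H as (ss & H1 & H2).
  rewrite Rabs_minus_sym in H1; eapply Rle_trans in H1; [|apply Rle_abs]; lra.
Qed.

Lemma lim_norm_seminorm : is_seminorm_coord lim_norm.
Proof.
  split; [|split].
  - intros a Ha; destruct (fin_supp_pos a Ha) as (m & Hm & Ham).
    apply (plegma_lim_ge m a); auto using lim_norm_spec.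
    exists 0%nat; intros ss _; now apply cnorm_ge0.
  - intros a b Ha Hb.
    destruct (fin_supp_pos a Ha) as (ma & Hma & Ham).
    destruct (fin_supp_pos b Hb) as (mb & Hmb & Hbm).
    set (m := Nat.max ma mb).
    assert (H1 : plegma_lim m a (lim_norm a))
      by (apply lim_norm_spec; [lia|]; intros; apply Ham; lia).
    assert (H2 : plegma_lim m b (lim_norm b))
      by (apply lim_norm_spec; [lia|]; intros; apply Hbm; lia).
    apply le_epsilon; intros eps He.
    apply (plegma_lim_le m (fun j => a j + b j)); [lia| |].
    + apply lim_norm_spec; [lia|]; intros; rewrite Ham, Hbm by lia; ring.
    + generalize (plegma_eventually_and k M m _ _ HM (H1 (eps / 2) ltac:(lra))
        (H2 (eps / 2) ltac:(lra))); apply plegma_eventually_mono; intros ss _ [H3 H4].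
      eapply Rle_trans in H3; [|apply Rle_abs].
      eapply Rle_trans in H4; [|apply Rle_abs].
      pose proof (cnorm_triangle X f f_le m a b ss); lra.
  - intros c a Ha; destruct (fin_supp_pos a Ha) as (m & Hm & Ham).
    apply (plegma_lim_unique m (fun j => c * a j)); [assumption| |].
    + apply lim_norm_spec; [assumption|]; intros; rewrite Ham by assumption; ring.
    + intros eps He; pose proof (Rabs_pos c).
      set (e := eps / (Rabs c + 1)).
      assert (He' : 0 < e) by (apply Rdiv_lt_0_compat; lra).
      assert (Hce : Rabs c * e <= eps).
      { assert (e * (Rabs c + 1) = eps) by (unfold e; field; lra). nra. }
      generalize (lim_norm_spec m a Hm Ham e He'); apply plegma_eventually_mono; intros ss _ H1.
      rewrite cnorm_scal by assumption.
      replace (Rabs c * cnorm X f m a ss - Rabs c * lim_norm a)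
        with (Rabs c * (cnorm X f m a ss - lim_norm a)) by ring.
      rewrite Rabs_mult, Rabs_Rabsolu.
      eapply Rle_trans; [|exact Hce]; apply Rmult_le_compat_l; lra.
Qed.

Lemma trunc_lt (m : nat) (a : nat -> R) (j : nat) : (j < m)%nat -> trunc m a j = a j.
Proof. intros Hj; unfold trunc; now rewrite (proj2 (Nat.ltb_lt j m) Hj). Qed.

Lemma trunc_ge (m : nat) (a : nat -> R) (j : nat) : (m <= j)%nat -> trunc m a j = 0.
Proof. intros Hj; unfold trunc; now rewrite (proj2 (Nat.ltb_ge j m) Hj). Qed.

Lemma lim_norm_trunc (m : nat) (a : nat -> R) :
  (1 <= m)%nat -> plegma_lim m a (lim_norm (trunc m a)).
Proof.
  intros Hm eps He; generalize (lim_norm_spec m (trunc m a) Hm (trunc_ge m a) eps He).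
  apply plegma_eventually_mono; intros ss _.
  rewrite (cnorm_ext X f m (trunc m a) a ss ss); auto using trunc_lt.
Qed.

Lemma lim_norm_close (m : nat) (a b : nat -> R) (e : R) :
  (1 <= m)%nat -> (forall j, (j < m)%nat -> Rabs (a j - b j) <= e) ->
  Rabs (lim_norm (trunc m a) - lim_norm (trunc m b)) <= INR m * e.
Proof.
  assert (Hone : forall a b, (1 <= m)%nat -> (forall j, (j < m)%nat -> Rabs (a j - b j) <= e) ->
    lim_norm (trunc m a) <= lim_norm (trunc m b) + INR m * e).
  { clear a b; intros a b Hm Hab; apply le_epsilon; intros eps He.
    apply (plegma_lim_le m a); auto using lim_norm_trunc.
    generalize (lim_norm_trunc m b Hm eps He); apply plegma_eventually_mono; intros ss _ H.
    pose proof (cnorm_close X f f_le m a b ss e Hab) as H'.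
    eapply Rle_trans in H; [|apply Rle_abs].
    eapply Rle_trans in H'; [|apply Rle_abs]; lra. }
  intros Hm Hab; apply Rabs_le; split.
  - assert (lim_norm (trunc m b) <= lim_norm (trunc m a) + INR m * e); [|lra].
    apply Hone; auto; intros j Hj; rewrite Rabs_minus_sym; auto.
  - specialize (Hone a b Hm Hab); lra.
Qed.

Lemma plegma_eventually_list {A : Type} (m : nat) (L : list A) (Q : A -> (nat -> list nat) -> Prop) :
  (forall b, plegma_eventually k M m (Q b)) ->
  plegma_eventually k M m (fun ss => forall b, In b L -> Q b ss).
Proof.
  intros H; induction L as [|b L IH].
  - exists 0%nat; intros ss _ b [].
  - generalize (plegma_eventually_and k M m _ _ HM (H b) IH); apply plegma_eventually_mono.
    intros ss _ [H1 H2] b' [<-|Hb']; auto.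
Qed.

(** Both [cnorm] and its limit are Lipschitz in the coefficients, so convergence at the points of a
    finite net of the cube suffices; the three error terms take [eps / 3] each. *)
Lemma plegma_lim_uniform (m : nat) (eps : R) :
  (1 <= m)%nat -> 0 < eps ->
  plegma_eventually k M m (fun ss => forall a, (forall j, (j < m)%nat -> -1 <= a j <= 1) ->
    Rabs (cnorm X f m a ss - lim_norm (trunc m a)) <= eps).
Proof.
  intros Hm He; pose proof (pos_INR m).
  set (e := eps / 3 / (INR m + 1)).
  assert (He' : 0 < e) by (apply Rdiv_lt_0_compat; lra).
  assert (Hme : INR m * e <= eps / 3).
  { assert (e * (INR m + 1) = eps / 3) by (unfold e; field; lra). nra. }
  destruct (cube_net m e He') as [L HL].
  generalize (plegma_eventually_list m L (fun b ss =>
    Rabs (cnorm X f m b ss - lim_norm (trunc m b)) <= eps / 3)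
    (fun b => lim_norm_trunc m b Hm (eps / 3) ltac:(lra))).
  apply plegma_eventually_mono; intros ss _ Hss a Ha.
  destruct (HL a Ha) as (b & Hb & Hab); specialize (Hss b Hb).
  pose proof (cnorm_close X f f_le m a b ss e Hab) as H1.
  pose proof (lim_norm_close m a b e Hm Hab) as H2; rewrite Rabs_minus_sym in H2.
  replace (cnorm X f m a ss - lim_norm (trunc m a)) with
    ((cnorm X f m a ss - cnorm X f m b ss) + (cnorm X f m b ss - lim_norm (trunc m b))
     + (lim_norm (trunc m b) - lim_norm (trunc m a))) by ring.
  eapply Rle_trans; [apply Rabs_triang|].
  pose proof (Rabs_triang (cnorm X f m a ss - cnorm X f m b ss)
    (cnorm X f m b ss - lim_norm (trunc m b))); lra.
Qed.

Lemma lim_norm_generated :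
  gen_spreading_model (fun _ => 0) (fun g h y => g y + h y) (fun c g y => c * g y)
    (dnorm X) k f lim_norm.
Proof.
  assert (Hg : forall n, exists N, forall m ss a, (1 <= m)%nat -> (m <= S n)%nat ->
    plegma_beyond k M N m ss -> (forall j, (j < m)%nat -> -1 <= a j <= 1) ->
    Rabs (cnorm X f m a ss - lim_norm (trunc m a)) <= / (INR (S n) + 1)).
  { intros n.
    assert (He : 0 < / (INR (S n) + 1))
      by (pose proof (pos_INR (S n)); apply Rinv_0_lt_compat; lra).
    (* The accuracy is detached from [n], so that the induction on the maximal length keeps it
       fixed. *)
    revert He; generalize (/ (INR (S n) + 1)) as eps; intros eps He.
    induction (S n) as [|n' [N HN]]; [exists 0%nat; intros; lia|].
    destruct (plegma_lim_uniform (S n') eps ltac:(lia) He) as [N' HN'].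
    exists (Nat.max N N'); intros m ss a Hm Hmn Hss Ha.
    destruct (Nat.eq_dec m (S n')) as [->|Hne].
    - apply HN'; [|assumption]. apply (plegma_beyond_weaken k M (Nat.max N N')); auto; lia.
    - apply HN; auto; [lia|]. apply (plegma_beyond_weaken k M (Nat.max N N')); auto; lia. }
  apply choice in Hg; destruct Hg as [g Hg].
  (* Thinning [M] by some [h >= g] turns the starting condition at position [pred l] into the
     threshold for all lengths up to [l]. *)
  destruct (strictly_incr_above g) as (h & Hh & Hgh).
  exists (fun i => M (h i)), (fun l => / (INR l + 1)); split; [|split; [|split]].
  - now apply (strictly_incr_comp M h).
  - intros l; pose proof (pos_INR l); apply Rinv_0_lt_compat; lra.
  - exact RinvN_cv.
  - intros l m ss a Hm Hml Hks Hpl Hmin Ha.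
    destruct l as [|n]; [lia|]; simpl pred in Hmin.
    apply (Hg n); auto; split; [|split; [assumption|]].
    + intros j Hj; now apply (ksub_comp k M h), Hks.
    + pose proof (strictly_incr_le M (g n) (h n) HM (Hgh n)); lia.
Qed.

Lemma lim_norm_equiv_l1 (c : R) :
  0 < c ->
  (forall m a, (1 <= m)%nat -> plegma_eventually k M m (fun ss => c * sumabs m a <= cnorm X f m a ss)) ->
  equiv_l1 lim_norm.
Proof.
  intros Hc Hlow; exists c, 1; split; [assumption|split; [lra|]]; intros m a.
  destruct m as [|m].
  (* Limits are taken at positive lengths, so the empty combination is read as one of length 1 with
     coefficient 0. *)
  - assert (H0 : lim_norm (trunc 0 a) = 0).
    { apply (plegma_lim_unique 1 (trunc 0 a)); [lia| |].
      - apply lim_norm_spec; [lia|]; intros; apply trunc_ge; lia.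
      - intros eps He; exists 0%nat; intros ss _.
        rewrite (cnorm_pad X f 0 1 (trunc 0 a) ss) by (auto; intros; apply trunc_ge; lia).
        pose proof (cnorm_le_sumabs X f f_le 0 (trunc 0 a) ss) as H; simpl in H.
        pose proof (cnorm_ge0 X f f_le 0 (trunc 0 a) ss); apply Rabs_le; lra. }
    rewrite H0; simpl; lra.
  - assert (Hm : (1 <= S m)%nat) by lia; pose proof (lim_norm_trunc (S m) a Hm) as Hlim.
    split.
    + apply (plegma_lim_ge (S m) a); auto.
    + apply (plegma_lim_le (S m) a); auto; exists 0%nat; intros ss _.
      pose proof (cnorm_le_sumabs X f f_le (S m) a ss); lra.
Qed.

End Limit.

(** * Almost biorthogonality *)

Section Biorthogonality.
Context (X : Banach) (f : list nat -> X -> R) (x : list nat -> X).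
Context (f_blf : forall s, is_blf X (f s)).
Context (f_le : forall s y, Rabs (f s y) <= bnorm X y).
Context (k : nat) (hk : (1 <= k)%nat) (M : nat -> nat) (HM : strictly_incr M).
Context (K : R) (c0_upper : forall m, (1 <= m)%nat -> plegma_eventually k M m (fun ss =>
  forall b, (forall j, (j < m)%nat -> -1 <= b j <= 1) ->
    bnorm X (comb (bzero X) (badd X) (bscal X) x m b ss) <= K)).

(** With signs as coefficients, the absolute row sum is the value of one contractive functional at a
    combination of norm at most [K]. *)
Lemma row_sum_bound (m : nat) :
  (1 <= m)%nat -> plegma_eventually k M m (fun ss =>
    forall p, (p < m)%nat -> rsum m (fun j => Rabs (f (ss p) (x (ss j)))) <= K).
Proof.
  intros Hm; generalize (c0_upper m Hm); apply plegma_eventually_mono; intros ss _ Hss p Hp.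
  set (b := fun j => sgn (f (ss p) (x (ss j)))).
  rewrite (rsum_ext m _ (fun j => b j * f (ss p) (x (ss j))))
    by (intros; unfold b; now rewrite sgn_mul).
  rewrite <- blf_comb by apply f_blf.
  eapply Rle_trans; [apply Rle_abs|]; eapply Rle_trans; [apply f_le|].
  apply Hss; intros; apply sgn_range.
Qed.

Lemma no_large_row (e : R) (p : nat -> nat) :
  0 < e -> (forall m, (1 <= m)%nat -> (p m < m)%nat) ->
  ~ (forall m, (1 <= m)%nat -> plegma_eventually k M m (fun ss =>
       forall j, (j < m)%nat -> j <> p m -> e <= Rabs (f (ss (p m)) (x (ss j))))).
Proof.
  intros He Hp Hlarge.
  (* A row of length [S n] has [n] entries off position [p (S n)]; they sum to at least [n e], which
     exceeds [K]. *)
  destruct (INR_unbounded (K / e)) as [n Hn].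
  assert (Hm : (1 <= S n)%nat) by lia.
  generalize (plegma_eventually_and k M (S n) _ _ HM (row_sum_bound (S n) Hm) (Hlarge (S n) Hm)).
  intros H; apply plegma_eventually_exists in H; try assumption; destruct H as (ss & H1 & H2).
  specialize (H1 (p (S n)) (Hp (S n) Hm)).
  pose proof (rsum_ge_except (S n) (p (S n)) (fun j => Rabs (f (ss (p (S n))) (x (ss j)))) e
    ltac:(lra) (fun j => Rabs_pos _) H2) as H3.
  rewrite S_INR in H3; apply (Rmult_lt_compat_r e) in Hn; [|assumption].
  replace (K / e * e) with K in Hn by (field; lra); lra.
Qed.

Lemma plegma_eventually_pairs (m : nat) (Q : list nat -> list nat -> Prop) :
  plegma_eventually k M 2 (fun ss => Q (ss 0%nat) (ss 1%nat)) ->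
  plegma_eventually k M m (fun ss => forall i j, (i < j)%nat -> (j < m)%nat -> Q (ss i) (ss j)).
Proof.
  intros HQ; generalize (plegma_eventually_sub k M m 2 _ hk ltac:(lia) HQ).
  apply plegma_eventually_mono; intros ss _ Hss i j Hij Hj.
  apply (Hss (fun p => match p with O => i | _ => j end)); [|exact Hj].
  intros [|p] Hp; lia.
Qed.

Context (pairs_fst : forall n,
  let Q ss := Rabs (f (ss 0%nat) (x (ss 1%nat))) < / (INR n + 1) in
  plegma_eventually k M 2 Q \/ plegma_eventually k M 2 (fun ss => ~ Q ss)).
Context (pairs_snd : forall n,
  let Q ss := Rabs (f (ss 1%nat) (x (ss 0%nat))) < / (INR n + 1) in
  plegma_eventually k M 2 Q \/ plegma_eventually k M 2 (fun ss => ~ Q ss)).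

(* A large value on plegma pairs would be a large value of one fixed functional at all the
   other members of arbitrarily long plegma families, against the c_0 upper estimate. *)
Lemma off_diagonal_small (m n : nat) :
  plegma_eventually k M m (fun ss => forall i j, (i < m)%nat -> (j < m)%nat -> i <> j ->
    Rabs (f (ss i) (x (ss j))) <= / (INR n + 1)).
Proof.
  assert (He : 0 < / (INR n + 1)) by (pose proof (pos_INR n); apply Rinv_0_lt_compat; lra).
  assert (H1 : plegma_eventually k M 2
    (fun ss => Rabs (f (ss 0%nat) (x (ss 1%nat))) < / (INR n + 1))).
  { destruct (pairs_fst n) as [H|H]; [exact H|exfalso].
    (* The functional of the first set precedes all the others, so each of its off-diagonal entries
       comes from a pair in this order. *)
    apply (no_large_row (/ (INR n + 1)) (fun _ => 0%nat) He); [intros; lia|].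
    intros m' Hm'; generalize (plegma_eventually_pairs m'
      (fun s t => ~ Rabs (f s (x t)) < / (INR n + 1)) H).
    apply plegma_eventually_mono; intros ss _ Hss j Hj Hne; apply Rnot_lt_le, Hss; lia. }
  assert (H2 : plegma_eventually k M 2
    (fun ss => Rabs (f (ss 1%nat) (x (ss 0%nat))) < / (INR n + 1))).
  { destruct (pairs_snd n) as [H|H]; [exact H|exfalso].
    (* In the opposite order the functional of the last set, index [pred m'], plays this role. *)
    apply (no_large_row (/ (INR n + 1)) pred He); [intros; lia|].
    intros m' Hm'; generalize (plegma_eventually_pairs m'
      (fun s t => ~ Rabs (f t (x s)) < / (INR n + 1)) H).
    apply plegma_eventually_mono; intros ss _ Hss j Hj Hne; apply Rnot_lt_le, Hss; lia. }
  generalize (plegma_eventually_and k M m _ _ HM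
    (plegma_eventually_pairs m (fun s t => Rabs (f s (x t)) < / (INR n + 1)) H1)
    (plegma_eventually_pairs m (fun s t => Rabs (f t (x s)) < / (INR n + 1)) H2)).
  apply plegma_eventually_mono; intros ss _ [H3 H4] i j Hi Hj Hne; left.
  destruct (Nat.lt_total i j) as [H|[H|H]]; [auto|lia|auto].
Qed.

(** The off-diagonal threshold [/ (n + 1)] is chosen after [m], with [m / (n + 1) <= c / 2]; only
    how far out the family must start depends on [m], not the constant. *)
Lemma cnorm_eventually_ge (c : R) :
  0 < K -> 0 < c ->
  plegma_eventually k M 1 (fun ss => c <= f (ss 0%nat) (x (ss 0%nat))) ->
  forall m a, (1 <= m)%nat -> plegma_eventually k M m (fun ss =>
    c / (2 * K) * sumabs m a <= cnorm X f m a ss).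
Proof.
  intros HK Hc Hdiag m a Hm; pose proof (pos_INR m).
  assert (Hmc : 0 < c / 2 / (INR m + 1)) by (apply Rdiv_lt_0_compat; lra).
  destruct (archimed_cor1 _ Hmc) as (n & Hn & Hn0); destruct n as [|n]; [lia|].
  rewrite S_INR in Hn; pose proof (pos_INR n).
  assert (He : 0 < / (INR n + 1)) by (apply Rinv_0_lt_compat; lra).
  assert (Hme : INR m * / (INR n + 1) <= c / 2).
  { apply (Rmult_lt_compat_r (INR m + 1)) in Hn; [|lra].
    replace (c / 2 / (INR m + 1) * (INR m + 1)) with (c / 2) in Hn by (field; lra); lra. }
  generalize (plegma_eventually_and k M m _ _ HM (c0_upper m Hm)
    (plegma_eventually_and k M m _ _ HM (off_diagonal_small m n)
      (plegma_eventually_sub k M m 1 _ hk ltac:(lia) Hdiag))).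
  apply plegma_eventually_mono; intros ss _ (H1 & H2 & H3).
  apply (cnorm_lower X f f_blf f_le x m a ss K c (/ (INR n + 1))); auto; [|lra].
  intros j Hj; apply (H3 (fun _ => j)); [intros; lia|exact Hj].
Qed.

End Biorthogonality.

(** * From a [c_0] spreading model in the space to an [l_1] spreading model in the dual *)

Theorem mainTheorem12 (X : Banach) (k : nat) (hk : (1 <= k)%nat) :
  (exists sn, in_SM_wrc X k sn /\ equiv_c0 sn) ->
  dual_admits_l1_ksm X k.
Proof.
  intros (sn & (_ & x & _ & M0 & delta & HM0 & _ & Hdelta & Hgen) & c & C & Hc & HC & Hc0).
  destruct (choice (fun s f => is_blf X f /\ (forall y, Rabs (f y) <= bnorm X y) /\
    f (x s) = bnorm X (x s)) (fun s => norming_functional X (x s))) as [f Hf].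
  assert (f_blf : forall s, is_blf X (f s)) by apply Hf.
  assert (f_le : forall s y, Rabs (f s y) <= bnorm X y) by apply Hf.
  (* One application of Ramsey's theorem decides everything: tags 0 and 1 stand for the two orders
     of a pair, and tag [S (S m)] for norms of combinations of length [S m], so that no length is
     0. *)
  pose (size n := match fst (Cantor.of_nat n) with
     | O | S O => 2%nat | S (S m) => S m end).
  pose (Q n ss := let r := snd (Cantor.of_nat n) in match fst (Cantor.of_nat n) with
     | O => Rabs (f (ss 0%nat) (x (ss 1%nat))) < / (INR r + 1)
     | S O => Rabs (f (ss 1%nat) (x (ss 0%nat))) < / (INR r + 1)
     | S (S m) => cnorm X f (S m)
         (fun j => rat_code (seq_code (fst (Cantor.of_nat r)) j)) ss
         < rat_code (snd (Cantor.of_nat r))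
     end).
  destruct (plegma_ramsey k size Q M0 hk) as (h & Hh & Hdich); [| |assumption|].
  { intros n; unfold size; destruct (fst (Cantor.of_nat n)) as [|[|m]]; lia. }
  { intros n ss ss'; unfold size, Q; destruct (fst (Cantor.of_nat n)) as [|[|m]]; intros Hss.
    - now rewrite !Hss by lia.
    - now rewrite !Hss by lia.
    - now rewrite (cnorm_ext X f (S m) _ _ ss ss' (fun _ _ => eq_refl) Hss). }
  set (M := fun i => M0 (h i)) in *.
  assert (HM : strictly_incr M) by now apply (strictly_incr_comp M0 h).
  assert (Hpair : forall t r, let n := Cantor.to_nat (t, r) in
    plegma_eventually k M (size n) (Q n) \/ plegma_eventually k M (size n) (fun ss => ~ Q n ss))
    by (intros; apply Hdich).
  unfold size, Q in Hpair; clear Hdich.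
  assert (Happrox : forall m eps, (1 <= m)%nat -> 0 < eps -> plegma_eventually k M m (fun ss =>
    forall b, (forall j, (j < m)%nat -> -1 <= b j <= 1) ->
      Rabs (bnorm X (comb (bzero X) (badd X) (bscal X) x m b ss) - sn (trunc m b)) <= eps)).
  { intros m eps Hm He; destruct (Hdelta eps He) as [N HN].
    (* This [l] admits families of length [m] and makes [delta l] smaller than [eps]; [pred l]
       matches the 1-based start in [gen_spreading_model]. *)
    set (l := Nat.max m N); exists (pred l); intros ss (H1 & H2 & H3) b Hb.
    specialize (HN l ltac:(lia)); unfold Rdist in HN; rewrite Rminus_0_r in HN.
    apply Rle_trans with (delta l); [|pose proof (Rle_abs (delta l)); lra].
    apply Hgen; auto; [lia| |].
    - intros j Hj; apply (ksub_comp k M0 h), H1, Hj.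
    - pose proof (strictly_incr_le M0 _ _ HM0 (strictly_incr_ge_id h (pred l) Hh)).
      unfold M in H3; lia. }
  (* [C] bounds the seminorm on the cube, and 1 is the approximation error. *)
  assert (Hup : forall m, (1 <= m)%nat -> plegma_eventually k M m (fun ss =>
    forall b, (forall j, (j < m)%nat -> -1 <= b j <= 1) ->
      bnorm X (comb (bzero X) (badd X) (bscal X) x m b ss) <= C + 1)).
  { intros m Hm; generalize (Happrox m 1 Hm Rlt_0_1); apply plegma_eventually_mono.
    intros ss _ Hss b Hb; specialize (Hss b Hb); destruct (Hc0 m b) as [_ H2].
    pose proof (maxabs_le1 m b Hb); eapply Rle_trans in Hss; [|apply Rle_abs]; nra. }
  (* A single basis vector has seminorm at least [c]; half of this is given up to the approximation,
     and [f_s (x_s)] equals the norm of [x_s]. *)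
  assert (Hlow : plegma_eventually k M 1 (fun ss => c / 2 <= f (ss 0%nat) (x (ss 0%nat)))).
  { generalize (Happrox 1%nat (c / 2) ltac:(lia) ltac:(lra)); apply plegma_eventually_mono.
    intros ss _ Hss; specialize (Hss (fun _ => 1) ltac:(intros; lra)).
    destruct (Hc0 1%nat (fun _ => 1)) as [H1 _]; simpl in Hss, H1.
    rewrite badd_comm, badd_0, bscal_1 in Hss; rewrite Rabs_R1, Rmax_right in H1 by lra.
    destruct (Hf (ss 0%nat)) as (_ & _ & ->).
    rewrite Rabs_minus_sym in Hss; eapply Rle_trans in Hss; [|apply Rle_abs]; lra. }
  assert (Hdich : forall m v q, (1 <= m)%nat ->
    let Q ss := cnorm X f m (fun j => rat_code (seq_code v j)) ss < rat_code q in
    plegma_eventually k M m Q \/ plegma_eventually k M m (fun ss => ~ Q ss)).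
  { intros m v q Hm; destruct m as [|m]; [lia|].
    specialize (Hpair (S (S m)) (Cantor.to_nat (v, q))); cbv zeta in Hpair.
    rewrite !Cantor.cancel_of_to in Hpair; cbn [fst snd] in Hpair.
    rewrite !Cantor.cancel_of_to in Hpair; exact Hpair. }
  exists f; split; [intros s _; apply f_blf|].
  exists (lim_norm X f k M); split; [|split].
  - now apply lim_norm_seminorm.
  - now apply lim_norm_generated.
  (* This is [c' / (2 K)] with diagonal bound [c' = c / 2] and [K = C + 1]. *)
  - apply lim_norm_equiv_l1 with (c := c / 2 / (2 * (C + 1))); try assumption.
    + apply Rdiv_lt_0_compat; lra.
    + apply (cnorm_eventually_ge X f x); try assumption; try lra.
      * intros n; specialize (Hpair 0%nat n); cbv zeta in Hpair.
        rewrite !Cantor.cancel_of_to in Hpair; exact Hpair.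
      * intros n; specialize (Hpair 1%nat n); cbv zeta in Hpair.
        rewrite !Cantor.cancel_of_to in Hpair; exact Hpair.
Qed.
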